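(* Let $M$ be a vertically $4$-connected matroid with a triangle $T = \{e,f,g\}$ such that none of $M \setminus e$, $M \setminus f$, $M \setminus g$ is vertically $4$-connected. Then either (1) $M$ has a cocircuit $C^*$ such that $|C^* \cap T| = 2$ and $M|C^* \cong U_{2,k} \oplus U_{2,2}$ for some integer $k \ge 2$; or (2) $r(M) \le 6$, and if $M$ has no restriction isomorphic to $U_{2,4}$, then $|E(M)| \le 11$, while if $|E(M)| = 11$, then $M$ has disjoint triangles $T_1$ and $T_2$, neither of which is $T$.
   Context: For a matroid $M$ with ground set $E$ and rank function $r$, the connectivity function is $\lambda_M(X) = r(X) + r(E-X) - r(M)$. For a positive integer $j$, a partition $(X,Y)$ of $E$ is a vertical $j$-separation of $M$ if $\lambda_M(X) < j$ and $\min\{r(X), r(Y)\} \ge j$. For an integer $k \ge 2$, $M$ is vertically $k$-connected if it has no vertical $j$-separation with $j < k$. A triangle is a $3$-element circuit. $M|C^*$ denotes restriction, $U_{m,n}$ is the uniform matroid of rank $m$ on $n$ elements, $\oplus$ is direct sum.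
   Formalization: The matroid M is additionally assumed simple (no loops, no parallel pairs); without this the claim is false, e.g. for U_{2,3} with 9 loops added, or M(K_4) with many elements added parallel to an element outside T. *)

(* Defs.v *)
From mathcomp Require Import all_boot.

Set Implicit Arguments.
Unset Strict Implicit.
Unset Printing Implicit Defensive.

Record matroid (T : finType) := Matroid {
  ground : {set T};
  indep : pred {set T};
  indep_ground : forall I : {set T}, indep I -> I \subset ground;
  indep0 : indep set0;
  indepS : forall I J : {set T}, I \subset J -> indep J -> indep I;
  indep_aug : forall I J : {set T}, indep I -> indep J -> #|I| < #|J| ->
    exists2 x, x \in J :\: I & indep (x |: I)
}.

Section Basics.
Variables (T : finType) (M : matroid T).
Implicit Types (B C I J K X Y : {set T}) (e : T) (j k : nat).

Definition rank X := \max_(I : {set T} | indep M I && (I \subset X)) #|I|.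

Definition base B := maxset (indep M) B.

Definition circuit C :=
  minset [pred X : {set T} | (X \subset ground M) && ~~ indep M X] C.

Definition triangle C := circuit C && (#|C| == 3).

(* No loops and no parallel pairs.  Vertical connectivity is insensitive to
   both, so it gives no bound on the size of the ground set by itself: adding
   loops to U_{2,3} preserves vertical 4-connectedness. *)
Definition simple := forall C, circuit C -> 2 < #|C|.

(* Natural-number subtraction is harmless here: the rank function is
   subadditive, so the difference is never truncated. *)
Definition connectivity X :=
  rank X + rank (ground M :\: X) - rank (ground M).

Definition vertical_separation j X Y :=
  [/\ 0 < j, X :|: Y = ground M, [disjoint X & Y],
      connectivity X < j & j <= minn (rank X) (rank Y)].

Definition vertically_connected k :=
  forall j X Y, j < k -> ~ vertical_separation j X Y.

Lemma indep_extend I J : indep M I -> indep M J ->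
  exists K : {set T}, [/\ I \subset K, K \subset I :|: J, indep M K & #|J| <= #|K|].
Proof.
move=> indI indJ; have [n] := ubnP (#|J| - #|I|).
elim: n => // n IHn in I indI *; rewrite ltnS => le_n.
have [leJI|ltIJ] := leqP #|J| #|I|; first by exists I; rewrite subxx subsetUl.
have [x /setDP[xJ xI] indxI] := indep_aug indI indJ ltIJ.
have cxI : #|x |: I| = #|I|.+1 by rewrite cardsU1 xI.
have [|K [sK Ks indK leK]] := IHn (x |: I) indxI.
  by rewrite cxI subnS; apply: leq_trans le_n; rewrite prednK // subn_gt0.
exists K; split=> //; first exact: subset_trans (subsetUr _ _) sK.
by rewrite (subset_trans Ks) // !subUset sub1set !inE xJ orbT subsetUl subsetUr.
Qed.

Lemma indep_leq_base I B : indep M I -> base B -> #|I| <= #|B|.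
Proof.
move=> indI /maxsetP[indB maxB].
have [K [sBK _ indK leIK]] := indep_extend indB indI.
by rewrite -(maxB K indK sBK).
Qed.

Lemma card_base B B' : base B -> base B' -> #|B| = #|B'|.
Proof.
move=> bB bB'; apply/eqP; rewrite eqn_leq.
by rewrite !indep_leq_base ?(maxsetp bB) ?(maxsetp bB').
Qed.

Lemma large_indep_base I B : indep M I -> base B -> #|B| <= #|I| -> base I.
Proof.
move=> indI bB leBI; apply/maxsetP; split=> // J indJ sIJ.
apply/eqP; rewrite eq_sym eqEcard sIJ /=.
exact: leq_trans (indep_leq_base indJ bB) leBI.
Qed.

Lemma base_ex : exists B, base B.
Proof. by have [B bB _] := maxset_exists (indep0 M); exists B. Qed.

Definition dual_indep : pred {set T} :=
  fun I => [exists B, base B && (I \subset ground M :\: B)].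

Lemma dual_indep_ground I : dual_indep I -> I \subset ground M.
Proof. by case/existsP=> B /andP[_]; rewrite subsetD => /andP[]. Qed.

Lemma dual_indep0 : dual_indep set0.
Proof. by have [B bB] := base_ex; apply/existsP; exists B; rewrite bB sub0set. Qed.

Lemma dual_indepS I J : I \subset J -> dual_indep J -> dual_indep I.
Proof.
move=> sIJ /existsP[B /andP[bB sJ]]; apply/existsP; exists B.
by rewrite bB (subset_trans sIJ).
Qed.

Lemma dual_indep_aug I J : dual_indep I -> dual_indep J -> #|I| < #|J| ->
  exists2 x, x \in J :\: I & dual_indep (x |: I).
Proof.
move=> /existsP[B1 /andP[bB1]]; rewrite subsetD => /andP[sIE dIB1].
move=> /existsP[B2 /andP[bB2]]; rewrite subsetD => /andP[sJE dJB2] ltIJ.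
have indA : indep M (B2 :\: I) := indepS (subsetDl _ _) (maxsetp bB2).
have [B [sAB sB indB leB]] := indep_extend indA (maxsetp bB1).
have bB : base B := large_indep_base indB bB1 leB.
have dIB : [disjoint I & B].
  rewrite disjoint_subset; apply/subsetP=> x xI; rewrite inE.
  apply/negP=> /(subsetP sB); rewrite !inE xI /=.
  by rewrite (disjointFr dIB1 xI).
have /subsetPn[x xJI xB] : ~~ (J :\: I \subset B).
  apply/negP=> sJIB.
  have dd : [disjoint J :\: I & B2 :\: I].
    exact: disjointW (subsetDl _ _) (subsetDl _ _) dJB2.
  have : #|J :\: I| + #|B2 :\: I| <= #|B|.
    have /eqP <- : #|(J :\: I) :|: (B2 :\: I)| == #|J :\: I| + #|B2 :\: I|.
      by rewrite (leq_card_setU _ _).2.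
    by rewrite subset_leq_card // subUset sJIB.
  rewrite (card_base bB bB2) -(cardsID I B2) leq_add2r leqNgt => /negP[].
  have sBI : B2 :&: I \subset I :\: J.
    apply/subsetP=> y; rewrite !inE => /andP[yB yI]; rewrite yI andbT.
    by apply/negP=> yJ; move: (disjointFr dJB2 yJ); rewrite yB.
  apply: leq_ltn_trans (subset_leq_card sBI) _.
  by rewrite -(ltn_add2l #|I :&: J|) cardsID setIC cardsID.
exists x => //; apply/existsP; exists B; rewrite bB subsetD /= subUset sIE andbT.
move/setDP: xJI => [xJ _]; rewrite sub1set (subsetP sJE) //=.
rewrite disjoint_subset; apply/subsetP=> y; rewrite !inE.
by case/predU1P=> [-> // | yI]; rewrite (disjointFr dIB yI).
Qed.

Definition dual :=
  Matroid dual_indep_ground dual_indep0 dual_indepS dual_indep_aug.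

Definition restrict_indep X : pred {set T} :=
  fun I => indep M I && (I \subset X).

Lemma restrict_indep_ground X I : restrict_indep X I -> I \subset ground M :&: X.
Proof. by case/andP=> /indep_ground sI sX; rewrite subsetI sI. Qed.

Lemma restrict_indep0 X : restrict_indep X set0.
Proof. by rewrite /restrict_indep indep0 sub0set. Qed.

Lemma restrict_indepS X I J :
  I \subset J -> restrict_indep X J -> restrict_indep X I.
Proof.
by move=> sIJ /andP[indJ sJX]; rewrite /restrict_indep (indepS sIJ) // (subset_trans sIJ).
Qed.

Lemma restrict_indep_aug X I J :
  restrict_indep X I -> restrict_indep X J -> #|I| < #|J| ->
  exists2 x, x \in J :\: I & restrict_indep X (x |: I).
Proof.
move=> /andP[indI sIX] /andP[indJ sJX] /(indep_aug indI indJ)[x xJI indx].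
exists x => //; rewrite /restrict_indep indx subUset sIX sub1set andbT.
by case/setDP: xJI => /(subsetP sJX).
Qed.

Definition restrict X :=
  Matroid (@restrict_indep_ground X) (restrict_indep0 X)
          (@restrict_indepS X) (@restrict_indep_aug X).

Definition delete e := restrict (ground M :\ e).

End Basics.

Definition cocircuit (T : finType) (M : matroid T) := circuit (dual M).

Section Uniform.
Variables m n : nat.

Definition uniform_indep : pred {set 'I_n} := fun I => #|I| <= m.

Lemma uniform_indep_ground I : uniform_indep I -> I \subset [set: 'I_n].
Proof. by rewrite subsetT. Qed.

Lemma uniform_indep0 : uniform_indep set0.
Proof. by rewrite /uniform_indep cards0. Qed.

Lemma uniform_indepS (I J : {set 'I_n}) :
  I \subset J -> uniform_indep J -> uniform_indep I.
Proof. by move/subset_leq_card; apply: leq_trans. Qed.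

Lemma uniform_indep_aug (I J : {set 'I_n}) :
  uniform_indep I -> uniform_indep J -> #|I| < #|J| ->
  exists2 x, x \in J :\: I & uniform_indep (x |: I).
Proof.
move=> _ indJ ltIJ.
have /subsetPn[x xJ xI] : ~~ (J \subset I).
  by apply: contraL ltIJ => /subset_leq_card; rewrite -leqNgt.
exists x; first by rewrite inE xI.
by rewrite /uniform_indep cardsU1 xI (leq_trans ltIJ).
Qed.

(* The uniform matroid of rank m on n elements, when m <= n. *)
Definition uniform :=
  Matroid uniform_indep_ground uniform_indep0 uniform_indepS uniform_indep_aug.

End Uniform.

Section DirectSum.
Variables (T1 T2 : finType) (M1 : matroid T1) (M2 : matroid T2).
Implicit Types I J : {set T1 + T2}.

Local Notation left I := (inl @^-1: I : {set T1}).
Local Notation right I := (inr @^-1: I : {set T2}).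

Definition dsum_ground : {set T1 + T2} :=
  (inl @: ground M1) :|: (inr @: ground M2).

Definition dsum_indep : pred {set T1 + T2} :=
  fun I => indep M1 (left I) && indep M2 (right I).

Lemma dsum_indep_ground I : dsum_indep I -> I \subset dsum_ground.
Proof.
case/andP=> /indep_ground/subsetP s1 /indep_ground/subsetP s2.
apply/subsetP=> -[x|x] xI; rewrite inE ?(imset_f inl) ?(imset_f inr) ?orbT //.
  by apply: s1; rewrite inE.
by apply: s2; rewrite inE.
Qed.

Lemma dsum_indep0 : dsum_indep set0.
Proof. by rewrite /dsum_indep !preimset0 !indep0. Qed.

Lemma dsum_indepS I J : I \subset J -> dsum_indep J -> dsum_indep I.
Proof.
by move=> sIJ /andP[i1 i2]; rewrite /dsum_indep !(indepS (preimsetS _ sIJ)).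
Qed.

Lemma card_dsum I : #|I| = #|left I| + #|right I|.
Proof.
rewrite -!sum1_card big_mkcond big_sumType /= -!big_mkcond /=.
by congr (_ + _); apply: eq_bigl => x; rewrite inE.
Qed.

Lemma dsum_indep_aug I J : dsum_indep I -> dsum_indep J -> #|I| < #|J| ->
  exists2 x, x \in J :\: I & dsum_indep (x |: I).
Proof.
move=> /andP[i1 i2] /andP[j1 j2]; rewrite !card_dsum => ltIJ.
have [lt1|le1] := ltnP #|left I| #|left J|.
  have [x xJI indx] := indep_aug i1 j1 lt1.
  exists (inl x); first by move: xJI; rewrite !inE.
  apply/andP; split.
    by congr indep: indx; apply/setP=> y; rewrite !inE.
  by congr indep: i2; apply/setP=> y; rewrite !inE.
have lt2 : #|right I| < #|right J|.
  by rewrite ltnNge; apply/negP=> le2; move: ltIJ; rewrite ltnNge leq_add.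
have [x xJI indx] := indep_aug i2 j2 lt2.
exists (inr x); first by move: xJI; rewrite !inE.
apply/andP; split.
  by congr indep: i1; apply/setP=> y; rewrite !inE.
by congr indep: indx; apply/setP=> y; rewrite !inE.
Qed.

Definition dsum :=
  Matroid dsum_indep_ground dsum_indep0 dsum_indepS dsum_indep_aug.

End DirectSum.

(* Isomorphisms are bijections of the ground sets, viewed as subtypes: the
   elements of the ambient types outside the ground sets play no role. *)
Definition isomorphic (T1 T2 : finType) (M1 : matroid T1) (M2 : matroid T2) :=
  exists2 f : {x | x \in ground M1} -> {x | x \in ground M2}, bijective f &
    forall X : {set {x | x \in ground M1}},
      indep M1 (val @: X) = indep M2 (val @: (f @: X)).

(* Main.v *)
Require Import Defs.
From mathcomp Require Import all_boot.
From mathcomp Require Import zify.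

Set Implicit Arguments.
Unset Strict Implicit.
Unset Printing Implicit Defensive.

(* For each [x] in the triangle [T = {x, y, z}], the failure of [M \ x] to be
   vertically 4-connected gives a partition [(Xy, Xz)] of [E - x] into two
   nonspanning sets with [r(Xy) + r(Xz) = r(M) + 2] (when [r(M) > 3]); neither
   side spans [x], so [y] and [z] lie on different sides.  Uncrossing the
   partitions for [x] and [y] by submodularity shows that [Xz :&: Yz], the
   intersection containing [z], has rank at most 2, or else [Xy :&: Yx] has rank
   at most 1; and that [Xy :&: Yz] and [Xz :&: Yx] both have rank at most 2, or
   else one of them has rank at most 1.  If a side is contained in a line plus a
   point, then the other side is a hyperplane whose complement contains a
   cocircuit of the type in (1).  Excluding this, the three partitions cut
   [E - T] into eight cells, and a case analysis on which of [Xz :&: Yz],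
   [Xy :&: Zy], [Yx :&: Zx] are lines bounds [r(M)] by covering two
   complementary sides by lines, and [|E|] by counting the cells. *)

(** * Rank *)

Section Rank.
Variables (T : finType) (M : matroid T).
Implicit Types (A B C I J L X Y Z : {set T}) (x y : T).

Local Notation E := (ground M).
Local Notation rk := (rank M).

Lemma leq_rank_indep I X : indep M I -> I \subset X -> #|I| <= rk X.
Proof. by move=> indI sIX; apply: leq_bigmax_cond; rewrite indI. Qed.

Lemma rank_witness X : exists I, [/\ indep M I, I \subset X & #|I| = rk X].
Proof.
have P0 : indep M set0 && (set0 \subset X) by rewrite indep0 sub0set.
have gt0 : 0 < #|[pred I | indep M I & I \subset X]|.
  by apply/card_gt0P; exists set0.
have [I /andP[indI sIX] eqI] := eq_bigmax_cond (fun I => #|I|) gt0.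
by exists I; split=> //; rewrite -eqI.
Qed.

Lemma rank_mono X Y : X \subset Y -> rk X <= rk Y.
Proof.
move=> sXY; have [I [indI sIX <-]] := rank_witness X.
exact: leq_rank_indep indI (subset_trans sIX sXY).
Qed.

Lemma rank_leq_card X : rk X <= #|X|.
Proof. by have [I [_ sIX <-]] := rank_witness X; exact: subset_leq_card. Qed.

Lemma indepE I : indep M I = (rk I == #|I|).
Proof.
apply/idP/eqP => [indI|eqI].
  by apply/eqP; rewrite eqn_leq rank_leq_card leq_rank_indep.
have [J [indJ sJI eqJ]] := rank_witness I.
suff <- : J = I by [].
by apply/eqP; rewrite eqEcard sJI eqJ eqI /=.
Qed.

Lemma basis_extend I X : indep M I -> I \subset X ->
  exists J, [/\ I \subset J, J \subset X, indep M J & #|J| = rk X].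
Proof.
move=> indI sIX; have [K [indK sKX eqK]] := rank_witness X.
have [J [sIJ sJ indJ leJ]] := indep_extend indI indK.
have sJX : J \subset X by rewrite (subset_trans sJ) // subUset sIX.
by exists J; split=> //; apply/eqP; rewrite eqn_leq leq_rank_indep //= -eqK.
Qed.

(** A basis of [X :&: Y] is extended to a basis [J] of [X :|: Y]; then inclusion-exclusion for
    [J :&: X] and [J :&: Y] gives the inequality. *)
Lemma rank_submod X Y : rk (X :|: Y) + rk (X :&: Y) <= rk X + rk Y.
Proof.
have [I [indI sI eqI]] := rank_witness (X :&: Y).
have [J [sIJ sJ indJ <-]] :=
  basis_extend indI (subset_trans sI (subset_trans (subsetIl X Y) (subsetUl X Y))).
have leX : #|J :&: X| <= rk X.
  by apply: leq_rank_indep (subsetIr _ _); apply: indepS indJ; apply: subsetIl.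
have leY : #|J :&: Y| <= rk Y.
  by apply: leq_rank_indep (subsetIr _ _); apply: indepS indJ; apply: subsetIl.
have leI : #|(J :&: X) :&: (J :&: Y)| = rk (X :&: Y).
  apply/eqP; rewrite eqn_leq; apply/andP; split.
    apply: leq_rank_indep; last by rewrite setIACA subsetIr.
    by apply: indepS indJ; rewrite setIACA setIid subsetIl.
  rewrite -eqI subset_leq_card // setIACA setIid subsetI sIJ //.
have := cardsUI (J :&: X) (J :&: Y); rewrite -setIUr (setIidPl sJ) leI; lia.
Qed.

Lemma rankU X Y : rk (X :|: Y) <= rk X + rk Y.
Proof. by have := rank_submod X Y; lia. Qed.

Lemma rankU1 x X : rk (x |: X) <= (rk X).+1.
Proof.
have := rankU [set x] X; have := rank_leq_card [set x]; rewrite cards1; lia.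
Qed.

Lemma rankU1_diminishing x X Y :
  X \subset Y -> rk (x |: X) <= rk X -> rk (x |: Y) <= rk Y.
Proof.
move=> sXY le1; have := rank_submod (x |: X) Y.
have -> : (x |: X) :|: Y = x |: Y by rewrite -setUA (setUidPr sXY).
have /rank_mono : X \subset (x |: X) :&: Y by rewrite subsetI sXY subsetUr.
lia.
Qed.

(** If the rank grew, a basis of [Z] could be augmented by a single element of [A], which would then
    lie outside the span of [Z]. *)
Lemma rank_closure Z A :
  (forall x, x \in A -> rk (x |: Z) <= rk Z) -> rk (Z :|: A) <= rk Z.
Proof.
move=> clA; rewrite leqNgt; apply/negP.
have [I [indI sIZ eqI]] := rank_witness Z.
have [J [indJ sJ <-]] := rank_witness (Z :|: A).
rewrite -eqI => /(indep_aug indI indJ)[x /setDP[xJ xI] indx].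
have cx : #|x |: I| = #|I|.+1 by rewrite cardsU1 xI.
have: #|x |: I| <= rk (x |: Z) by apply: leq_rank_indep (setUS _ sIZ).
suff: rk (x |: Z) <= rk Z by lia.
have /setUP[xZ|/clA//] := subsetP sJ x xJ.
by rewrite (setUidPr _) ?sub1set.
Qed.

Lemma rank_setU_line A B : rk A <= 2 -> rk B <= 2 -> 1 < rk (A :&: B) ->
  rk (A :|: B) <= 2.
Proof. by have := rank_submod A B; lia. Qed.

Lemma base_rank B : base M B = indep M B && (#|B| == rk E).
Proof.
apply/idP/andP => [bB|[indB /eqP eqB]].
  have indB := maxsetp bB; have sBE := indep_ground indB.
  have [J [sBJ _ indJ <-]] := basis_extend indB sBE.
  by have /maxsetP[_ /(_ J indJ sBJ) ->] := bB.
have [B' bB'] := base_ex M; have indB' := maxsetp bB'.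
apply: large_indep_base indB bB' _.
by rewrite eqB; apply: leq_rank_indep indB' (indep_ground indB').
Qed.

Lemma dual_indepE I : indep (dual M) I = (I \subset E) && (rk (E :\: I) == rk E).
Proof.
apply/existsP/andP => [[B /andP[bB]]|[sIE /eqP rI]].
  rewrite subsetD => /andP[sIE dIB]; split=> //.
  move: bB; rewrite base_rank => /andP[indB /eqP eqB].
  rewrite eqn_leq rank_mono ?subsetDl // -eqB leq_rank_indep //.
  by rewrite subsetD (indep_ground indB) disjoint_sym.
have [B [indB sB eqB]] := rank_witness (E :\: I).
exists B; rewrite base_rank indB eqB rI eqxx /= subsetD sIE disjoint_sym.
by move: sB; rewrite subsetD => /andP[].
Qed.

End Rank.

(** * Isomorphism, simplicity and connectivity *)

Section Isomorphism.

Lemma isomorphic_by (T1 T2 : finType) (M1 : matroid T1) (M2 : matroid T2)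
    (phi : T1 -> T2) :
  {in ground M1 &, injective phi} -> phi @: ground M1 = ground M2 ->
  (forall X : {set T1}, X \subset ground M1 -> indep M1 X = indep M2 (phi @: X)) ->
  isomorphic M1 M2.
Proof.
move=> inj_phi im_phi ind_phi.
have phiE (u : {x | x \in ground M1}) : phi (val u) \in ground M2.
  by rewrite -im_phi imset_f ?(valP u).
pose F u : {x | x \in ground M2} := exist _ (phi (val u)) (phiE u).
have injF : injective F.
  move=> u v /(congr1 val) /= eq_uv; apply: val_inj.
  by apply: inj_phi eq_uv; apply: valP.
exists F.
  apply: inj_card_bij injF _.
  by rewrite !card_sig -im_phi -[X in _ <= X](card_in_imset inj_phi).
move=> X; rewrite ind_phi; first by rewrite -!imset_comp.
by apply/subsetP=> _ /imsetP[u _ ->]; apply: valP.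
Qed.

Variables (T : finType) (M : matroid T).
Implicit Types (A B C L X : {set T}).

Lemma ground_restrict X : X \subset ground M -> ground (restrict M X) = X.
Proof. by move/setIidPr. Qed.

Lemma isomorphic_uniform A m : A \subset ground M -> 0 < #|A| ->
  (forall X, X \subset A -> indep M X = (#|X| <= m)) ->
  isomorphic (restrict M A) (uniform m #|A|).
Proof.
move=> sAE /card_gt0P[a Aa] indA.
have inj_phi : {in A &, injective (enum_rank_in Aa)} by exact: enum_rank_in_inj.
apply: (@isomorphic_by _ _ _ _ (enum_rank_in Aa)); rewrite ground_restrict //.
  by apply/setP=> i; rewrite inE; apply/imsetP; exists (enum_val i);
    rewrite ?enum_valK_in ?enum_valP.
move=> X sXA; rewrite /= /restrict_indep sXA andbT indA // /uniform_indep.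
by rewrite card_in_imset // => x y /(subsetP sXA) + /(subsetP sXA); apply: inj_phi.
Qed.

Lemma isomorphic_dsum_uniform A B m n :
  A \subset ground M -> B \subset ground M -> [disjoint A & B] ->
  0 < #|A| -> 0 < #|B| ->
  (forall X, X \subset A :|: B ->
     indep M X = (#|X :&: A| <= m) && (#|X :&: B| <= n)) ->
  isomorphic (restrict M (A :|: B)) (dsum (uniform m #|A|) (uniform n #|B|)).
Proof.
move=> sAE sBE dAB /card_gt0P[a Aa] /card_gt0P[b Bb] indAB.
pose phi x : 'I_#|A| + 'I_#|B| :=
  if x \in A then inl (enum_rank_in Aa x) else inr (enum_rank_in Bb x).
have phiA x : x \in A -> phi x = inl (enum_rank_in Aa x) by rewrite /phi => ->.
have phiB x : x \in B -> phi x = inr (enum_rank_in Bb x).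
  by rewrite /phi => Bx; rewrite (disjointFl dAB Bx).
have inj_phi : {in A :|: B &, injective phi}.
  move=> x y /setUP[] Xx /setUP[] Xy;
    rewrite ?(phiA _ Xx) ?(phiA _ Xy) ?(phiB _ Xx) ?(phiB _ Xy) //.
    by case; apply: enum_rank_in_inj.
  by case; apply: enum_rank_in_inj.
have sABE : A :|: B \subset ground M by rewrite subUset sAE.
apply: (@isomorphic_by _ _ _ _ phi); rewrite ground_restrict //.
  apply/setP=> -[i|i]; rewrite !inE.
    rewrite imset_f ?inE //=; apply/imsetP; exists (enum_val i).
      by rewrite inE enum_valP.
    by rewrite phiA ?enum_valP // enum_valK_in.
  rewrite [X in _ = _ || X]imset_f ?inE ?orbT //=; apply/imsetP; exists (enum_val i).
    by rewrite inE enum_valP orbT.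
  by rewrite phiB ?enum_valP // enum_valK_in.
move=> X sX; rewrite /= /restrict_indep sX andbT indAB // /dsum_indep /= /uniform_indep.
have injX (Y : {set T}) : {in X :&: Y &, injective phi}.
  move=> x y /setIP[/(subsetP sX) Xx _] /setIP[/(subsetP sX) Xy _].
  exact: inj_phi.
rewrite -(card_in_imset (injX A)) -(card_in_imset (injX B)).
(* On [X], [phi] carries the part in [A] exactly to the left summand and the part in [B] to the
   right one, so the cardinalities agree. *)
have -> : phi @: (X :&: A) = inl @: (inl @^-1: (phi @: X)).
  apply/setP=> u; apply/imsetP/imsetP=> [[x /setIP[Xx Ax] ->]|[i]].
    exists (enum_rank_in Aa x); last by rewrite phiA.
    by rewrite inE; apply/imsetP; exists x => //; rewrite phiA.
  rewrite inE => /imsetP[x Xx]; rewrite /phi; case: ifP => // Ax [->] ->.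
  by exists x; rewrite ?inE ?Xx //; rewrite Ax.
have -> : phi @: (X :&: B) = inr @: (inr @^-1: (phi @: X)).
  apply/setP=> u; apply/imsetP/imsetP=> [[x /setIP[Xx Bx] ->]|[i]].
    exists (enum_rank_in Bb x); last by rewrite phiB.
    by rewrite inE; apply/imsetP; exists x => //; rewrite phiB.
  rewrite inE => /imsetP[x Xx]; have /setUP[Ax|Bx] := subsetP sX x Xx.
    by rewrite phiA.
  by rewrite phiB // => -[->] ->; exists x; rewrite ?inE ?Xx // phiB.
by rewrite !card_imset //; [move=> ? ? [] | move=> ? ? []].
Qed.

End Isomorphism.

Section Simple.
Variables (T : finType) (M : matroid T).
Hypothesis simpleM : simple M.
Implicit Types (A C L X Y : {set T}).

Local Notation E := (ground M).
Local Notation rk := (rank M).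

Lemma simple_indep X : X \subset E -> #|X| <= 2 -> indep M X.
Proof.
move=> sXE leX; apply: contraT => depX.
pose P := [pred Y : {set T} | (Y \subset E) && ~~ indep M Y].
have [C minC sCX] : {C | minset P C & C \subset X}.
  by apply: minset_exists; rewrite /= sXE.
by have := simpleM minC; rewrite ltnNge (leq_trans (subset_leq_card sCX)).
Qed.

Lemma simple_rank_gt1 X : X \subset E -> 1 < #|X| -> 1 < rk X.
Proof.
move=> sXE /card_gt1P[x [y [Xx Xy neq]]].
have sP : [set x; y] \subset X by rewrite subUset !sub1set Xx.
have cP : #|[set x; y]| = 2 by rewrite cards2 neq.
have indP : indep M [set x; y] by apply: simple_indep; rewrite ?cP ?(subset_trans sP).
by rewrite -cP; apply: leq_rank_indep sP.
Qed.

Lemma simple_rank_leq1 X : X \subset E -> rk X <= 1 -> #|X| <= 1.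
Proof. by move=> sXE; rewrite leqNgt; apply: contraNleq; apply: simple_rank_gt1. Qed.

Lemma triangle_rank X : X \subset E -> #|X| = 3 -> rk X <= 2 -> triangle M X.
Proof.
move=> sXE cX rX; rewrite /triangle cX eqxx andbT; apply/minsetP; split.
  by rewrite /= sXE indepE cX neq_ltn ltnS rX.
move=> Y /andP[sYE depY] sYX; apply/eqP; rewrite eqEcard sYX cX leqNgt ltnS.
by apply: contra depY; apply: simple_indep.
Qed.

Lemma subset_card_ex X m : m <= #|X| -> exists2 Y : {set T}, Y \subset X & #|Y| = m.
Proof.
move=> leX; exists [set x in take m (enum X)].
  by apply/subsetP=> x; rewrite inE => /mem_take; rewrite mem_enum.
by rewrite cardsE (card_uniqP _) ?take_uniq ?enum_uniq // size_takel // -cardE.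
Qed.

(** Any four points of a line induce [uniform 2 4]: simplicity makes all pairs independent, and the
    rank bound makes all triples dependent. *)
Lemma simple_line_card X : 
  (forall Y : {set T}, Y \subset E -> ~ isomorphic (restrict M Y) (uniform 2 4)) ->
  X \subset E -> rk X <= 2 -> #|X| <= 3.
Proof.
move=> noU sXE rX; rewrite leqNgt; apply/negP=> /subset_card_ex[Y sYX cY].
have sYE := subset_trans sYX sXE.
apply: (noU Y sYE); rewrite -[4]cY.
apply: isomorphic_uniform => //; first by rewrite cY.
move=> Z sZY; have sZE := subset_trans sZY sYE.
apply/idP/idP; last exact: simple_indep.
rewrite indepE => /eqP <-; apply: leq_trans rX.
exact: rank_mono (subset_trans sZY sYX).
Qed.

End Simple.

Section Connectivity.
Variables (T : finType) (M : matroid T).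
Implicit Types (C L X Y Z : {set T}) (x y : T).

Local Notation E := (ground M).
Local Notation rk := (rank M).
Local Notation r := (rank M (ground M)).

Lemma vertically_4connected_rank X : vertically_connected M 4 ->
  X \subset E -> rk X < r -> rk (E :\: X) < r -> r + 3 <= rk X + rk (E :\: X).
Proof.
move=> conM sXE ltX ltY; rewrite leqNgt; apply/negP=> lt3.
(* The order is the connectivity plus one, the least possible; it is at most the rank of each side
   because the other side is nonspanning. *)
apply: (conM (rk X + rk (E :\: X) - r).+1 X (E :\: X)); first by lia.
have EX : X :|: (E :\: X) = E by rewrite -{1}(setIidPr sXE) setID.
have := rankU M X (E :\: X); rewrite EX => ler.
split=> //; last by rewrite leq_min; lia.
by rewrite -setI_eq0 setIDA setDIl setDv set0I.
Qed.

(** If deleting [x] keeps the rank, a vertical separation of [delete M x] of order at most 3 has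
    this form: connectivity at most 2 gives the last bound, and a rank of at least [j] on one side
    makes the other side nonspanning. *)
Definition split_off x X Y :=
  [/\ X :|: Y = E :\ x, [disjoint X & Y], rk X < r, rk Y < r &
      rk X + rk Y <= r + 2].

Lemma split_off_sym x X Y : split_off x X Y -> split_off x Y X.
Proof.
by case=> UXY dXY ltX ltY le2; split; rewrite // 1?setUC 1?disjoint_sym // addnC.
Qed.

Lemma rank_delete x X : X \subset E :\ x -> rank (delete M x) X = rk X.
Proof.
move=> sX; apply: eq_bigl => I /=; rewrite /restrict_indep -andbA; congr (_ && _).
by apply: andb_idl => sIX; apply: subset_trans sX.
Qed.

Lemma not_vertically_connected_delete x : rk (E :\ x) = r ->
  ~ vertically_connected (delete M x) 4 -> exists X Y, split_off x X Y.
Proof.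
move=> rx ncon.
(* [ncon] only refutes a universal statement; a boolean form of [split_off] lets the existence of
   [X] and [Y] be decided. *)
pose P (X Y : {set T}) :=
  [&& X :|: Y == E :\ x, [disjoint X & Y], rk X < r, rk Y < r & rk X + rk Y <= r + 2].
have [/existsP[X /existsP[Y /and5P[/eqP UXY dXY ltX ltY le2]]]|] :=
    boolP [exists X, exists Y, P X Y]; first by exists X, Y.
move/negP=> noP; case: ncon => j X Y ltj [j0 UXY dXY lam lejr]; case: noP.
have gE : ground (delete M x) = E :\ x by rewrite ground_restrict ?subsetDl.
rewrite gE in UXY; have sX : X \subset E :\ x by rewrite -UXY subsetUl.
have sY : Y \subset E :\ x by rewrite -UXY subsetUr.
have DX : (E :\ x) :\: X = Y.
  by rewrite -UXY setDUl setDv set0U; apply/setDidPl; rewrite disjoint_sym.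
move: lam lejr; rewrite /connectivity gE DX leq_min !rank_delete // rx.
by move=> lam /andP[jX jY]; apply/existsP; exists X; apply/existsP; exists Y;
  apply/and5P; split; rewrite ?UXY //; lia.
Qed.

End Connectivity.

(** * Crossing partitions *)

Section Splits.
Variables (T : finType) (M : matroid T).
Hypotheses (simpleM : simple M) (conM : vertically_connected M 4).
Implicit Types (A C D L S W X Y Z : {set T}) (x y z : T).

Local Notation E := (ground M).
Local Notation rk := (rank M).
Local Notation r := (rank M (ground M)).

(** If the complement is nonspanning, 4-connectivity gives connectivity at least 3; if it spans, the
    connectivity is [rk S] itself. *)
Lemma leq_connectivity S : S \subset E -> rk S < r ->
  minn 3 (rk S) + r <= rk S + rk (E :\: S).
Proof.
move=> sSE ltS; have [ltD|] := ltnP (rk (E :\: S)) r; last by lia.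
by have := vertically_4connected_rank conM sSE ltS ltD; lia.
Qed.

Lemma split_off_mem x X Y v : split_off M x X Y -> v \in E ->
  (v \in Y) = (v != x) && (v \notin X).
Proof.
case=> UXY dXY _ _ _ Ev; have /setP/(_ v) := UXY; rewrite !inE Ev andbT => <-.
by case: (boolP (v \in X)) => //= Xv; [rewrite (disjointFr dXY Xv) | rewrite andbT].
Qed.

Lemma split_off_sub x X Y : split_off M x X Y -> X \subset E :\ x.
Proof. by case=> <- _ _ _ _; apply: subsetUl. Qed.

Lemma split_off_subE x X Y : split_off M x X Y -> X \subset E.
Proof. by move/split_off_sub/subset_trans; apply; apply: subsetDl. Qed.

Lemma split_off_notin x X Y : split_off M x X Y -> x \notin X.
Proof. by move/split_off_sub; rewrite subsetD1 => /andP[]. Qed.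

Lemma split_off_compl x X Y : x \in E -> split_off M x X Y -> E :\: X = x |: Y.
Proof.
move=> Ex sXY; apply/setP=> v; rewrite !inE.
have [Ev|nEv] := boolP (v \in E).
  rewrite (split_off_mem sXY Ev) andbT; case: eqP => //= ->.
  by rewrite (split_off_notin sXY).
have [eqv|_] := eqVneq v x; first by rewrite eqv Ex in nEv.
rewrite andbF; apply/esym/negbTE; apply: contra nEv.
exact: (subsetP (split_off_subE (split_off_sym sXY))).
Qed.

(** If [X] spanned [x], then [x |: X] and [Y] would partition [E] into nonspanning sets of
    connectivity at most 2. *)
Lemma split_off_rankU1 x X Y : x \in E -> split_off M x X Y ->
  rk X < rk (x |: X).
Proof.
move=> Ex sXY; rewrite ltnNge; apply/negP=> lex.
have sX : x |: X \subset E by rewrite subUset sub1set Ex (split_off_subE sXY).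
have DX : E :\: (x |: X) = Y.
  apply/setP=> v; have [Ev|nEv] := boolP (v \in E).
    by rewrite (split_off_mem sXY Ev) !inE Ev negb_or andbT.
  rewrite !inE (negbTE nEv) andbF; apply/esym/negbTE; apply: contra nEv.
  exact: (subsetP (split_off_subE (split_off_sym sXY))).
case: sXY => _ _ ltX ltY le2.
by have := vertically_4connected_rank conM sX; rewrite DX; lia.
Qed.

(** If [x |: X] or [x |: Y] is nonspanning, 4-connectivity gives the lower bound, [x] costing at
    most one. If both span, both sides have rank [r - 1], and [2r - 2] is at least [r + 2] because
    [r] exceeds 3. *)
Lemma split_off_rank_sum x X Y : 3 < r -> x \in E -> split_off M x X Y ->
  rk X + rk Y = r + 2.
Proof.
move=> r4 Ex sXY; apply/eqP; rewrite eqn_leq; case: (sXY) => _ _ ltX ltY -> /=.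
have sYX := split_off_sym sXY.
have := vertically_4connected_rank conM (split_off_subE sXY) ltX.
have := vertically_4connected_rank conM (split_off_subE sYX) ltY.
rewrite (split_off_compl Ex sXY) (split_off_compl Ex sYX).
by have := rankU1 M x X; have := rankU1 M x Y; lia.
Qed.

Lemma card_split x X Y A : x \in E -> split_off M x X Y -> A \subset E ->
  #|A| = (x \in A) + #|A :&: X| + #|A :&: Y|.
Proof.
move=> Ex sXY sAE; rewrite (cardsD1 x A) -addnA; congr (_ + _).
rewrite -(cardsID X (A :\ x)); congr (_ + _); apply: eq_card => v; rewrite !inE.
  have [Xv|] := boolP (v \in X); last by rewrite !andbF.
  rewrite !andbT; case: eqP => // eqv.
  by rewrite eqv (negbTE (split_off_notin sXY)) in Xv.
have [Av|] := boolP (v \in A); last by rewrite !andbF.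
by rewrite (split_off_mem sXY (subsetP sAE v Av)) andbC andbT.
Qed.

Lemma rank_split x X Y A : x \in E -> split_off M x X Y -> A \subset E ->
  rk A <= (x \in A) + rk (A :&: X) + rk (A :&: Y).
Proof.
move=> Ex sXY sAE.
have sA : A \subset [set v in A | v == x] :|: ((A :&: X) :|: (A :&: Y)).
  apply/subsetP=> v Av; rewrite !inE Av /=.
  by rewrite (split_off_mem sXY (subsetP sAE v Av)); case: eqP; case: (v \in X).
apply: leq_trans (rank_mono M sA) _; apply: leq_trans (rankU _ _ _) _.
rewrite -addnA leq_add ?rankU //; apply: leq_trans (rank_leq_card _ _) _.
have [Ax|nAx] := boolP (x \in A).
  apply: leq_trans (_ : #|[set x]| <= 1); last by rewrite cards1.
  by rewrite subset_leq_card //; apply/subsetP=> v; rewrite !inE => /andP[].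
rewrite leqn0 cards_eq0; apply/eqP/setP=> v; rewrite !inE.
by apply/negbTE/andP=> -[Av /eqP eqv]; rewrite -eqv Av in nAx.
Qed.

(* The closure of [X] misses [z], so it meets a line through [z] in at most one
   point. *)
Lemma line_split_card z X Y A : z \in E -> split_off M z X Y -> A \subset E ->
  z \in A -> rk A <= 2 -> #|A :&: X| <= 1.
Proof.
move=> Ez sXY sAE Az rA; rewrite leqNgt; apply/negP.
move/(simple_rank_gt1 simpleM (subset_trans (subsetIl A X) sAE)) => gt1.
suff: rk (z |: X) <= rk X by have := split_off_rankU1 Ez sXY; lia.
apply: (rankU1_diminishing (subsetIr A X)).
apply: leq_trans gt1; apply: leq_trans rA; apply: rank_mono.
by rewrite subUset sub1set Az subsetIl.
Qed.

Variable T0 : {set T}.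
(* By simplicity and rank counting, such a [C] is a line of rank 2 together with
   two further points, freely placed; only the bounds needed to see this are
   recorded. *)
Definition line_pair_cocircuit C :=
  [&& cocircuit M C, #|C :&: T0| == 2, 3 < rk C &
      [exists L : {set T}, (rk L <= 2) && (#|C :\: L| <= 2)]].

Lemma line_pair_cocircuit_isomorphic C : line_pair_cocircuit C ->
  exists2 k, 2 <= k & isomorphic (restrict M C) (dsum (uniform 2 k) (uniform 2 2)).
Proof.
case/and4P=> cocC _ rC /existsP[L /andP[rL cL]].
have sCE : C \subset E by case/minsetp/andP: cocC.
set A := C :&: L; set B := C :\: L in cL *.
have sAE : A \subset E := subset_trans (subsetIl _ _) sCE.
have sBE : B \subset E := subset_trans (subsetDl _ _) sCE.
have CE : C = A :|: B by rewrite setID.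
have dAB : [disjoint A & B].
  rewrite -setI_eq0; apply/eqP/setP=> v; rewrite !inE.
  by case: (v \in C); case: (v \in L).
have rA : rk A <= 2 := leq_trans (rank_mono M (subsetIr C L)) rL.
have := rankU M A B; have := rank_leq_card M B; have := rank_leq_card M A.
rewrite -CE => leA leB leC.
have cB : #|B| = 2 by lia.
exists #|A|; first by lia.
suff: isomorphic (restrict M C) (dsum (uniform 2 #|A|) (uniform 2 #|B|)) by rewrite cB.
rewrite {1}CE; apply: isomorphic_dsum_uniform => //; try lia.
move=> X sX; have sXE : X \subset E by rewrite (subset_trans sX) // -CE.
have sXA := subset_trans (subsetIl X A) sXE.
have -> : #|X :&: B| <= 2 by rewrite -cB subset_leq_card ?subsetIr.
rewrite andbT; apply/idP/idP => [indX|/(simple_indep simpleM sXA) indXA].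
  apply: leq_trans rA; apply: leq_rank_indep (subsetIr _ _).
  by apply: indepS indX; apply: subsetIl.
(* [X] lies in [J :|: B], where [J] is a basis of [A]. Submodularity against [A] gives this set rank
   at least [rk C], hence at least 4, and it has at most 4 elements, so it is independent. *)
have [J [sJ sJA indJ cJ]] := basis_extend indXA (subsetIr X A).
have sXJ : X \subset J :|: B.
  apply/subsetP=> v Xv; have := subsetP sX v Xv.
  rewrite !in_setU => /orP[Av|->]; last exact: orbT.
  by rewrite (subsetP sJ) // inE Xv.
apply: indepS sXJ _; rewrite indepE eqn_leq rank_leq_card /=.
have := rank_submod M A (J :|: B).
have -> : A :|: (J :|: B) = C by rewrite setUA (setUidPl sJA) -CE.
have : rk J <= rk (A :&: (J :|: B)) by apply: rank_mono; rewrite subsetI sJA subsetUl.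
have -> : rk J = #|J| by apply/eqP; rewrite -indepE.
have [+ _] := leq_card_setU J B; rewrite cJ cB.
by move: rC rA; clear; lia.
Qed.

Hypothesis triT0 : triangle M T0.

Lemma triangle_sub : T0 \subset E.
Proof. by case/andP: triT0 => /minsetp/andP[]. Qed.

Lemma triangle_card : #|T0| = 3.
Proof. by case/andP: triT0 => _ /eqP. Qed.

Lemma triangle_span x y z X : x \in T0 -> y \in T0 -> x != y -> z \in T0 ->
  x \in X -> y \in X -> rk (z |: X) <= rk X.
Proof.
move=> Tx Ty neq Tz Xx Xy.
have sP : [set x; y] \subset T0 by rewrite subUset !sub1set Tx.
apply: (@rankU1_diminishing _ M z [set x; y]); first by rewrite subUset !sub1set Xx.
have : 1 < rk [set x; y].
  by apply: simple_rank_gt1; rewrite ?cards2 ?neq ?(subset_trans sP) ?triangle_sub.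
apply: leq_trans; apply: leq_trans (_ : rk T0 <= 2).
  by apply: rank_mono; rewrite subUset sub1set Tz.
have /andP[/minsetp/andP[_]] := triT0; rewrite indepE => + /eqP.
have := rank_leq_card M T0; lia.
Qed.

Hypothesis rM : 3 < r.

(** The cocircuit is the complement of the closure of [Z]. The closure contains exactly one point of
    the triangle, since two would span [x]. The cocircuit has rank at least 4, either by
    4-connectivity or because it spans, and it lies in [E :\: Z], which is a line with at most two
    more points. *)
Lemma hyperplane_line_pair Z L x y : Z \subset E -> rk Z + 1 = r ->
  x \in T0 -> y \in T0 -> y \in Z -> rk Z < rk (x |: Z) ->
  rk L <= 2 -> #|(E :\: Z) :\: L| <= 2 -> exists C, line_pair_cocircuit C.
Proof.
move=> sZE rZ Tx Ty Zy ltx rL cL.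
pose C := [set v in E | rk Z < rk (v |: Z)].
have sCE : C \subset E by apply/subsetP=> v; rewrite inE => /andP[].
have CP v : v \in E :\: C -> rk (v |: Z) <= rk Z.
  by rewrite !inE => /andP[+ Ev]; rewrite Ev /= -leqNgt.
have sZC : Z \subset E :\: C.
  apply/subsetP=> v Zv; rewrite !inE (subsetP sZE _ Zv) andbT /= -leqNgt.
  by rewrite (setUidPr _) ?sub1set.
have rD : rk (E :\: C) < r.
  have := rank_closure CP; rewrite (setUidPr sZC); lia.
exists C; apply/and4P; split.
- apply/minsetP; rewrite /= sCE; split=> [|D].
    by rewrite (_ : dual_indep M C = indep (dual M) C) // dual_indepE sCE /= neq_ltn rD.
  case/andP=> sDE; rewrite (_ : dual_indep M D = indep (dual M) D) // dual_indepE.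
  rewrite sDE /= => neqD sDC; apply/eqP; rewrite eqEsubset sDC /=.
  (* If [D] omits [v], its complement contains both [Z] and a point outside the closure of [Z], and
     so it spans. *)
  apply/subsetP=> v Cv; apply: contraR neqD => nDv.
  rewrite eqn_leq rank_mono ?subsetDl //=.
  have: v |: Z \subset E :\: D.
    rewrite subUset sub1set inE nDv (subsetP sCE v Cv) /=.
    exact: subset_trans sZC (setDS _ sDC).
  move/(rank_mono M)/(leq_trans _); apply.
  by move: Cv; rewrite inE => /andP[_]; rewrite -rZ addn1.
- suff -> : C :&: T0 = T0 :\ y by have := cardsD1 y T0; rewrite Ty triangle_card; lia.
  apply/setP=> v; rewrite [LHS]inE in_setD1.
  have [Tv|_] := boolP (v \in T0); last by rewrite !andbF.
  have Ev := subsetP triangle_sub v Tv.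
  rewrite !andbT !inE Ev /=; case: eqP => [->|/eqP neqv].
    by rewrite (setUidPr _) ?sub1set // ltnn.
  rewrite ltnNge; apply/negP=> lev.
  have := triangle_span (X := v |: Z) Tv Ty neqv Tx (setU11 _ _) (setU1r _ Zy).
  have : rk (x |: Z) <= rk (x |: (v |: Z)) by apply: rank_mono; rewrite setUS ?subsetUr.
  by move: ltx lev; clear; lia.
- have [ltC|] := ltnP (rk C) r; last by lia.
  have := rank_closure CP; rewrite (setUidPr sZC) => leZ.
  have := vertically_4connected_rank conM sCE ltC rD.
  by move: leZ rZ; clear; lia.
- apply/existsP; exists L; rewrite rL /=; apply: leq_trans cL.
  rewrite subset_leq_card // setSD //; apply/subsetP=> v Cv.
  rewrite inE (subsetP sCE v Cv) andbT; apply/negP=> /(subsetP sZC).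
  by rewrite inE Cv.
Qed.

(** Here [Y] has rank at most 3, so the rank sum [r + 2] gives [X] rank [r - 1]. Its complement
    [x |: Y] is a line with at most two more points, one of them [x]. *)
Lemma thin_split x y X Y L : x \in T0 -> y \in T0 -> split_off M x X Y ->
  y \in X -> rk (Y :&: L) <= 2 -> #|Y :\: L| <= 1 ->
  exists C, line_pair_cocircuit C.
Proof.
move=> Tx Ty sXY Xy rL cL; have Ex := subsetP triangle_sub x Tx.
apply: (@hyperplane_line_pair X (Y :&: L) x y) => //.
- exact: split_off_subE sXY.
- have := rankU M (Y :&: L) (Y :\: L); rewrite setID.
  have := rank_leq_card M (Y :\: L); have := split_off_rank_sum rM Ex sXY.
  by case: sXY => _ _ ? _ _; lia.
- exact: split_off_rankU1 sXY.
rewrite (split_off_compl Ex sXY).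
apply: leq_trans (_ : #|x |: (Y :\: L)| <= 2).
  apply: subset_leq_card; apply/subsetP=> v; rewrite !inE.
  by case: (v \in Y); case: (v \in L); rewrite ?andbF ?orbF ?orbT //= ?andbT.
by have := cardsU1 x (Y :\: L); case: (_ \notin _); lia.
Qed.

(** * Uncrossing two partitions *)

Section Crossing.
Variables (x y z : T) (Xy Xz Yx Yz : {set T}).
Hypotheses (Tx : x \in T0) (Ty : y \in T0) (Tz : z \in T0).
Hypotheses (neq_xy : x != y) (neq_xz : x != z) (neq_yz : y != z).
Hypotheses (sX : split_off M x Xy Xz) (sY : split_off M y Yx Yz).
Hypotheses (Xyy : y \in Xy) (Xzz : z \in Xz) (Yxx : x \in Yx) (Yzz : z \in Yz).

Let inE0 := subsetP triangle_sub.

Lemma crossing_parallel :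
  [\/ rk (Xz :&: Yz) <= 2, rk (Xy :&: Yx) <= 1 | exists C, line_pair_cocircuit C].
Proof.
have [?|gt2] := leqP (rk (Xz :&: Yz)) 2; first by constructor 1.
have [?|gt1] := leqP (rk (Xy :&: Yx)) 1; first by constructor 2.
constructor 3.
have sXyE := split_off_subE sX; have sXzE := split_off_subE (split_off_sym sX).
have sYxE := split_off_subE sY; have sYzE := split_off_subE (split_off_sym sY).
have sIE : Xz :&: Yz \subset E := subset_trans (subsetIl _ _) sXzE.
have sDE : Xy :&: Yx \subset E := subset_trans (subsetIl _ _) sXyE.
have sWE : Xz :|: Yz \subset E by rewrite subUset sXzE.
case: (sX) => _ _ ltXy ltXz leX; case: (sY) => _ _ ltYx ltYz leY.
have ltI : rk (Xz :&: Yz) < r := leq_ltn_trans (rank_mono M (subsetIl _ _)) ltXz.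
have ltD : rk (Xy :&: Yx) < r := leq_ltn_trans (rank_mono M (subsetIl _ _)) ltXy.
have := leq_connectivity sIE ltI.
have -> : E :\: (Xz :&: Yz) = Xy :|: Yx.
  apply/setP=> v; have [Ev|nEv] := boolP (v \in E); last first.
    by rewrite !inE (negbTE nEv) andbF; apply/esym/negbTE; apply: contra nEv => /orP[];
      [apply: (subsetP sXyE) | apply: (subsetP sYxE)].
  rewrite !inE Ev andbT (split_off_mem sX Ev) (split_off_mem sY Ev).
  have [->|_] := eqVneq v x; first by rewrite Yxx orbT.
  have [->|_] := eqVneq v y; first by rewrite Xyy andbF.
  by rewrite /= negb_and !negbK.
have := leq_connectivity sDE ltD.
have DE : E :\: (Xy :&: Yx) = y |: (x |: (Xz :|: Yz)).
  apply/setP=> v; have [Ev|nEv] := boolP (v \in E); last first.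
    rewrite !inE (negbTE nEv) andbF; apply/esym/negbTE; apply: contra nEv.
    case/or4P=> [/eqP-> | /eqP-> | | ]; [exact: inE0 | exact: inE0 | |].
      exact: (subsetP sXzE).
    exact: (subsetP sYzE).
  rewrite !inE Ev andbT (split_off_mem sX Ev) (split_off_mem sY Ev).
  have [->|_] := eqVneq v y.
    by rewrite (negbTE (split_off_notin sY)) andbF.
  have [->|_] := eqVneq v x; first by rewrite (negbTE (split_off_notin sX)).
  by rewrite /= negb_and.
rewrite DE.
have := triangle_span (X := x |: (Xz :|: Yz)) Tx Tz neq_xz Ty (setU11 _ _).
rewrite !inE Xzz orbT => /(_ isT) ley.
move=> lamD lamI; have subz := rank_submod M Xz Yz.
have subyx := rank_submod M Xy Yx; have lexW := rankU1 M x (Xz :|: Yz).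
(* The two submodular inequalities bound the four ranks by [2r + 4] in total. The connectivities, at
   least 3 and at least 2, require [2r + 5] once [x] is added to [Xz :|: Yz], which then spans [y].
   So [x] must raise the rank by one and everything else is tight. *)
have [rD rW ltW] : [/\ rk (Xy :&: Yx) <= 2, rk (Xz :|: Yz) + 1 = r &
    rk (Xz :|: Yz) < rk (x |: (Xz :|: Yz))].
  by move: ley lamD lamI subz subyx lexW leX leY gt1 gt2; clear; split; lia.
apply: (@hyperplane_line_pair (Xz :|: Yz) (Xy :&: Yx) x z) => //.
  by rewrite inE Xzz.
apply: leq_trans (_ : #|[set x; y]| <= 2); last by rewrite cards2 neq_xy.
apply: subset_leq_card; apply/subsetP=> v; rewrite 2!in_setD => /andP[nD /andP[nW Ev]].
have : v \in E :\: (Xy :&: Yx) by rewrite in_setD nD.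
rewrite DE [in X in X -> _]in_setU [in X in X -> _]in_setU.
by rewrite (negbTE nW) orbF !in_set1 in_set2 orbC.
Qed.

(** Unlike in the parallel case no rank is lost: [Xz :|: Yx] contains [x] and [z] and so spans [y],
    while [Xy :|: Yz] contains [y] and [z] and so spans [x]. The two connectivities therefore sum to
    at most [2r + 4 - 2r]. *)
Lemma crossing_skew : minn 3 (rk (Xy :&: Yz)) + minn 3 (rk (Xz :&: Yx)) <= 4.
Proof.
have sXyE := split_off_subE sX; have sXzE := split_off_subE (split_off_sym sX).
have sYxE := split_off_subE sY; have sYzE := split_off_subE (split_off_sym sY).
have sIE : Xy :&: Yz \subset E := subset_trans (subsetIl _ _) sXyE.
have sDE : Xz :&: Yx \subset E := subset_trans (subsetIl _ _) sXzE.
case: (sX) => _ _ ltXy ltXz leX; case: (sY) => _ _ ltYx ltYz leY.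
have ltI : rk (Xy :&: Yz) < r := leq_ltn_trans (rank_mono M (subsetIl _ _)) ltXy.
have ltD : rk (Xz :&: Yx) < r := leq_ltn_trans (rank_mono M (subsetIl _ _)) ltXz.
have := leq_connectivity sIE ltI; have := leq_connectivity sDE ltD.
have /(rank_mono M) : E :\: (Xy :&: Yz) \subset y |: (Xz :|: Yx).
  apply/subsetP=> v; rewrite !inE => /andP[+ Ev].
  rewrite (split_off_mem sX Ev) (split_off_mem sY Ev).
  have [->|_] := eqVneq v x; first by rewrite Yxx !orbT.
  by case: (v == y); case: (v \in Xy); case: (v \in Yx).
have /(rank_mono M) : E :\: (Xz :&: Yx) \subset x |: (Xy :|: Yz).
  apply/subsetP=> v; rewrite !inE => /andP[+ Ev].
  rewrite (split_off_mem sX Ev) (split_off_mem sY Ev).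
  have [->|_] := eqVneq v y; first by rewrite Xyy ?orbT.
  by case: (v == x); case: (v \in Xy); case: (v \in Yx).
have := triangle_span (X := Xz :|: Yx) Tx Tz neq_xz Ty.
have := triangle_span (X := Xy :|: Yz) Ty Tz neq_yz Tx.
rewrite !inE Xyy Xzz Yxx Yzz !orbT => /(_ isT isT) + /(_ isT isT).
move: (rank_submod M Xy Yz) (rank_submod M Xz Yx) leX leY; clear; lia.
Qed.

Lemma crossing_diff : (Xz :\: Yz = Xz :&: Yx) * (Xz :\: Yx = Xz :&: Yz).
Proof.
have nXzy : y \notin Xz.
  by rewrite (split_off_mem sX (inE0 Ty)) Xyy andbF.
by split; apply/setP=> v; rewrite !inE;
  have [Xv|] := boolP (v \in Xz); rewrite ?andbF //=;
  have Ev := subsetP (split_off_subE (split_off_sym sX)) v Xv;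
  rewrite (split_off_mem sY Ev) ?andbT;
  have -> : v != y by [apply: contraNneq nXzy => <-];
  rewrite /= ?negbK ?andbT.
Qed.

Hypothesis noC : ~ exists C, line_pair_cocircuit C.

(** Otherwise [Xz] would be a line plus at most one point, which [thin_split] excludes. *)
Lemma crossing_card_skew : rk (Xz :&: Yz) <= 2 -> 1 < #|Xz :&: Yx|.
Proof.
move=> rS; rewrite -crossing_diff ltnNge; apply/negP=> le1.
exact: noC (thin_split Tx Ty sX Xyy rS le1).
Qed.

Lemma crossing_card_parallel : rk (Xz :&: Yx) <= 2 -> 1 < #|Xz :&: Yz|.
Proof.
move=> rS; rewrite -crossing_diff ltnNge; apply/negP=> le1.
exact: noC (thin_split Tx Ty sX Xyy rS le1).
Qed.

End Crossing.

End Splits.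

(* [h1], ..., [h6], [p], [q] are the sizes of the eight cells, in the order
   Xy Yx Zx, Xy Yx Zy, Xy Yz Zy, Xz Yz Zy, Xz Yz Zx, Xz Yx Zx, Xy Yz Zx, Xz Yx Zy:
   the first six form a hexagon, and the last two are antipodal vertices of the
   cube.  [a], [b], [c], [d] are the ranks of the edges [Xy :&: Yz],
   [Xz :&: Yx], [Xy :&: Zx], [Xz :&: Zy]. *)
Section Counting.
Variables h1 h2 h3 h4 h5 h6 p q : nat.
Local Notation total := (h1 + h2 + h3 + h4 + h5 + h6 + p + q).

(** This counts a vertex of the cube with its three neighbours. When [n] exceeds 1, any two edges at
    the vertex merge into one line of at most three points, and the total is at most 3; so 4 is
    reached only with [n] and all neighbours equal to 1. *)
Lemma count_star a1 a2 a3 n : a1 <= 1 -> a2 <= 1 -> a3 <= 1 ->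
  (1 < n -> n + a1 + a2 <= 3) -> (1 < n -> n + a1 + a3 <= 3) ->
  (1 < n -> n + a2 + a3 <= 3) ->
  n + (a1 + a2 + a3) <= 4 /\ (n + (a1 + a2 + a3) = 4 -> [/\ a1 = 1, a2 = 1 & a3 = 1]).
Proof.
move=> l1 l2 l3 N12 N13 N23; have [n1|n1] := leqP n 1.
  by move: l1 l2 l3 n1; clear; split; [lia | split; lia].
by move: n1 (N12 n1) (N13 n1) (N23 n1); clear; split; [lia | split; lia].
Qed.

(** The cube is the disjoint union of the stars at the antipodal vertices [p] and [q], each of total
    at most 4. *)
Lemma count_three_lines :
  h1 <= 1 -> h2 <= 1 -> h3 <= 1 -> h4 <= 1 -> h5 <= 1 -> h6 <= 1 ->
  (1 < p -> p + h1 + h3 <= 3) -> (1 < p -> p + h1 + h5 <= 3) ->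
  (1 < p -> p + h3 + h5 <= 3) -> (1 < q -> q + h2 + h4 <= 3) ->
  (1 < q -> q + h2 + h6 <= 3) -> (1 < q -> q + h4 + h6 <= 3) ->
  total <= 8 /\ (total = 8 -> h1 + h6 = 2 /\ h4 + h5 = 2).
Proof.
move=> l1 l2 l3 l4 l5 l6 P13 P15 P35 Q24 Q26 Q46.
have [leP eqP] := count_star l1 l3 l5 P13 P15 P35.
have [leQ eqQ] := count_star l2 l4 l6 Q24 Q26 Q46.
split=> [|e8]; first by move: leP leQ; clear; lia.
have [|-> _ ->] := eqP; first by move: leP leQ e8; clear; lia.
by have [|_ -> ->] := eqQ; first by move: leP leQ e8; clear; lia.
Qed.

Lemma skew_leq1 a b : minn 3 a + minn 3 b <= 4 -> 2 < a -> b <= 1.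
Proof. by move=> + /minn_idPl e3; rewrite e3 (leq_add2l 3 _ 1) geq_min. Qed.

(** The cases are whether [p] and [q] exceed 1; they cannot both be at most 1, since [h5 + h6 <= 1].
    Each alternative for total 8 names two disjoint edges with three points each. *)
Lemma count_two_lines c d :
  h1 <= 1 -> h4 <= 1 -> h5 + h6 <= 1 -> 1 < h2 + h3 ->
  1 < p + h3 <= 3 -> 1 < q + h6 <= 3 -> 1 < q + h2 <= 3 -> 1 < p + h5 <= 3 ->
  minn 3 c + minn 3 d <= 4 -> (c <= 1 -> p + h1 <= 1) -> (d <= 1 -> q + h4 <= 1) ->
  (1 < p -> p + h3 + h5 <= 3) -> (1 < p -> c <= 2 -> p + h1 + h3 <= 3) ->
  (1 < q -> q + h2 + h6 <= 3) -> (1 < q -> d <= 2 -> q + h2 + h4 <= 3) ->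
  total <= 8 /\ (total = 8 ->
    p + h3 = 3 /\ q + h2 = 3 \/
    c <= 2 /\ p + h1 = 3 /\ q + h2 = 3 \/ d <= 2 /\ q + h4 = 3 /\ p + h3 = 3).
Proof.
move=> l1 l4 l56 g23 /andP[g3 l3] /andP[g6 l6] /andP[g2 l2] /andP[g5 l5].
move=> skew C D P35 P13 Q26 Q24.
have [p1|p1] := leqP p 1; have [q1|q1] := leqP q 1.
- by exfalso; move: l56 g6 g5 p1 q1; clear; lia.
- have [d2|d3] := leqP d 2.
    move: l1 l56 g5 p1 q1 l3 g3 g23 d2 (Q24 q1 d2); clear => *.
    split=> [|e8]; first by lia.
    have [h40|h40] := posnP h4; [left; split; lia | right; right; split=> //; split; lia].
  have c1 : c <= 1 by apply: skew_leq1 d3; rewrite addnC.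
  move: (C c1) l1 l4 l56 g5 p1 l3 l2; clear => *.
  by split=> [|e8]; [lia | left; split; lia].
- have [c2|c3] := leqP c 2.
    move: l4 l56 g6 p1 q1 l2 g2 g23 c2 (P13 p1 c2); clear => *.
    split=> [|e8]; first by lia.
    have [h10|h10] := posnP h1; [left; split; lia | right; left; split=> //; split; lia].
  move: (D (skew_leq1 skew c3)) l1 l4 l56 g6 q1 l3 l2; clear => *.
  by split=> [|e8]; [lia | left; split; lia].
- move: l1 l4 l56 g23 p1 q1 (P35 p1) (Q26 q1); clear => *.
  by split=> [|e8]; [lia | left; split; lia].
Qed.

Lemma rank_one_line a b c d :
  h5 + h6 <= 1 -> h1 + h2 <= 1 -> 1 < h2 + h3 -> 1 < h4 + h5 ->
  1 < q + h2 -> 1 < p + h5 -> 0 < h1 + h6 ->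
  minn 3 a + minn 3 b <= 4 -> minn 3 c + minn 3 d <= 4 ->
  (b <= 1 -> q + h6 <= 1) -> (c <= 1 -> p + h1 <= 1) -> a <= 2 /\ d <= 2.
Proof.
move=> l56 l12 g23 g45 g2 g5 g16 skew_ab skew_cd B C.
split; rewrite leqNgt; apply/negP=> gt2.
  by move: (B (skew_leq1 skew_ab gt2)) l12 g2 g16; clear; lia.
have c1 : c <= 1 by apply: skew_leq1 gt2; rewrite addnC.
by move: (C c1) l56 g5 g16; clear; lia.
Qed.

End Counting.

(** * Three partitions *)

Section ThreeSplits.
Variables (T : finType) (M : matroid T) (T0 : {set T}).
Hypotheses (simpleM : simple M) (conM : vertically_connected M 4).
Hypotheses (triT0 : triangle M T0) (rM : 3 < rank M (ground M)).
Hypothesis noC : ~ exists C, line_pair_cocircuit M T0 C.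
Implicit Types (x y z : T) (A B C D X Y Z Xy Xz Yx Yz Zx Zy : {set T}).

Local Notation E := (ground M).
Local Notation rk := (rank M).
Local Notation r := (rank M (ground M)).

Let inE0 := subsetP (triangle_sub triT0).

Definition no_four_point_line :=
  forall X, X \subset E -> ~ isomorphic (restrict M X) (uniform 2 4).

Definition small_ground :=
  #|E| <= 11 /\ (#|E| = 11 -> exists T1 T2,
    [/\ triangle M T1, triangle M T2, [disjoint T1 & T2], T1 <> T0 & T2 <> T0]).

Lemma small_ground_triangles x y A B : x \in T0 -> y \in T0 ->
  x \notin A -> y \notin B -> A \subset E -> B \subset E -> [disjoint A & B] ->
  rk A <= 2 -> rk B <= 2 -> #|A| = 3 -> #|B| = 3 ->
  exists T1 T2,
    [/\ triangle M T1, triangle M T2, [disjoint T1 & T2], T1 <> T0 & T2 <> T0].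
Proof.
move=> Tx Ty nAx nBy sAE sBE dAB rA rB cA cB; exists A, B; split=> //.
- exact: triangle_rank.
- exact: triangle_rank.
- by move=> eqA; rewrite eqA Tx in nAx.
- by move=> eqB; rewrite eqB Ty in nBy.
Qed.

(** Lines sharing two points have a union of rank at most 2, which has at most three points;
    inclusion-exclusion does the rest. *)
Lemma concurrent_lines_card A B C : no_four_point_line -> A \subset E ->
  1 < #|A :&: B :&: C| -> rk (A :&: B) <= 2 -> rk (A :&: C) <= 2 ->
  #|A :&: B| + #|A :&: C| <= 3 + #|A :&: B :&: C|.
Proof.
move=> noU sAE gt1 rB rC.
have I : (A :&: B) :&: (A :&: C) = A :&: B :&: C by rewrite setIACA setIid setIA.
have sI : A :&: B :&: C \subset E by rewrite -setIA (subset_trans _ sAE) ?subsetIl.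
have gtI := simple_rank_gt1 simpleM sI gt1.
rewrite -cardsUI I leq_add2r; apply: (simple_line_card simpleM noU).
  by rewrite -setIUr (subset_trans _ sAE) ?subsetIl.
by apply: rank_setU_line; rewrite ?I.
Qed.

Definition three_splits x y z Xy Xz Yx Yz Zx Zy :=
  [/\ [/\ x \in T0, y \in T0 & z \in T0], [/\ x != y, x != z & y != z],
      [/\ split_off M x Xy Xz, split_off M y Yx Yz & split_off M z Zx Zy],
      y \in Xy /\ z \in Xz & [/\ x \in Yx, z \in Yz, x \in Zx & y \in Zy]].

(** Rotation and swap generate all permutations of the triangle, so facts about the partitions for
    [x] and [y] transfer to every pair. *)
Lemma three_splits_rot x y z Xy Xz Yx Yz Zx Zy :
  three_splits x y z Xy Xz Yx Yz Zx Zy -> three_splits y z x Yz Yx Zy Zx Xy Xz.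
Proof.
case=> -[Tx Ty Tz] [nxy nxz nyz] [sX sY sZ] [Xyy Xzz] [Yxx Yzz Zxx Zyy].
by split; split=> //; rewrite 1?eq_sym // ; exact: split_off_sym.
Qed.

Lemma three_splits_swap x y z Xy Xz Yx Yz Zx Zy :
  three_splits x y z Xy Xz Yx Yz Zx Zy -> three_splits x z y Xz Xy Zx Zy Yx Yz.
Proof.
case=> -[Tx Ty Tz] [nxy nxz nyz] [sX sY sZ] [Xyy Xzz] [Yxx Yzz Zxx Zyy].
by split; split=> //; rewrite 1?eq_sym // ; exact: split_off_sym.
Qed.

(** * Edges and cells of the cube *)

Section Cells.
Variables (x y z : T) (Xy Xz Yx Yz Zx Zy : {set T}).
Hypothesis splits : three_splits x y z Xy Xz Yx Yz Zx Zy.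

Lemma sides_sub : [/\ Xy \subset E, Xz \subset E & [/\ Yx \subset E, Yz \subset E,
  Zx \subset E & Zy \subset E]].
Proof.
have [_ _ [sX sY sZ] _ _] := splits.
by split; last split; (exact: split_off_subE sX || exact: split_off_subE sY ||
  exact: split_off_subE sZ || exact: split_off_subE (split_off_sym sX) ||
  exact: split_off_subE (split_off_sym sY) || exact: split_off_subE (split_off_sym sZ)).
Qed.

Lemma sides_notin : [/\ x \notin Xy, x \notin Xz, z \notin Xy & y \notin Xz] /\
  [/\ y \notin Yx, y \notin Yz, z \notin Yx & x \notin Yz] /\
  [/\ z \notin Zx, z \notin Zy, y \notin Zx & x \notin Zy].
Proof.
have [[Tx Ty Tz] _ [sX sY sZ] [Xyy Xzz] [Yxx Yzz Zxx Zyy]] := splits.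
have := (split_off_sym sX, split_off_sym sY, split_off_sym sZ) => -[[sX' sY'] sZ'].
rewrite (split_off_notin sX) (split_off_notin sX') (split_off_notin sY).
rewrite (split_off_notin sY') (split_off_notin sZ) (split_off_notin sZ').
rewrite (split_off_mem sX' (inE0 Tz)) (split_off_mem sX (inE0 Ty)).
rewrite (split_off_mem sY' (inE0 Tz)) (split_off_mem sY (inE0 Tx)).
rewrite (split_off_mem sZ' (inE0 Ty)) (split_off_mem sZ (inE0 Tx)).
by rewrite Xyy Xzz Yxx Yzz Zxx Zyy !andbF.
Qed.

(** The line passes through [z], so each side of the partition for [z] meets it at most once. Both
    skew edges have at least two points, hence rank at least 2, and [crossing_skew] then makes both
    ranks equal to 2. *)
Lemma crossing_line : rk (Xz :&: Yz) <= 2 ->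
  [/\ #|Xz :&: Yz :&: Zx| <= 1, #|Xz :&: Yz :&: Zy| <= 1 &
    [/\ 1 < #|Xy :&: Yz|, 1 < #|Xz :&: Yx|, rk (Xy :&: Yz) <= 2 & rk (Xz :&: Yx) <= 2]].
Proof.
have [[Tx Ty Tz] [nxy nxz nyz] [sX sY sZ] [Xyy Xzz] [Yxx Yzz Zxx Zyy]] := splits.
have [sXyE sXzE _] := sides_sub.
move=> rS; have sS : Xz :&: Yz \subset E := subset_trans (subsetIl _ _) sXzE.
have sS' : Xy :&: Yz \subset E := subset_trans (subsetIl _ _) sXyE.
have sS'' : Xz :&: Yx \subset E := subset_trans (subsetIl _ _) sXzE.
have zS : z \in Xz :&: Yz by rewrite inE Xzz.
have c1 := crossing_card_skew simpleM conM triT0 rM Tx Ty sX sY Xyy noC rS.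
rewrite setIC in rS.
have := crossing_card_skew simpleM conM triT0 rM Ty Tx sY sX Yxx noC rS.
rewrite setIC in rS *; rewrite [Yz :&: _]setIC => c2.
have := crossing_skew simpleM conM triT0 Tx Ty Tz nxz nyz sX sY Xyy Xzz Yxx Yzz.
have := simple_rank_gt1 simpleM sS' c2; have := simple_rank_gt1 simpleM sS'' c1.
move=> g1 g2 le4; split; [| |split=> //].
- exact: (line_split_card simpleM conM (inE0 Tz) sZ sS).
- exact: (line_split_card simpleM conM (inE0 Tz) (split_off_sym sZ) sS).
- by move: g1 g2 le4; clear; lia.
- by move: g1 g2 le4; clear; lia.
Qed.

Lemma crossing_nonline : 2 < rk (Xz :&: Yz) ->
  #|Xy :&: Yx| <= 1 /\ 2 < #|Xz :&: Yz|.
Proof.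
have [[Tx Ty Tz] [nxy nxz nyz] [sX sY sZ] [Xyy Xzz] [Yxx Yzz Zxx Zyy]] := splits.
have [sXyE _ _] := sides_sub.
move=> rS; split; last exact: leq_trans rS (rank_leq_card _ _).
apply: (simple_rank_leq1 simpleM); first exact: subset_trans (subsetIl _ _) sXyE.
have [||/noC//] :=
  crossing_parallel simpleM conM triT0 rM Tx Ty Tz nxy nxz sX sY Xyy Xzz Yxx.
  by rewrite leqNgt rS.
by [].
Qed.

Lemma crossing_skew_rank : minn 3 (rk (Xy :&: Yz)) + minn 3 (rk (Xz :&: Yx)) <= 4.
Proof.
have [[Tx Ty Tz] [nxy nxz nyz] [sX sY sZ] [Xyy Xzz] [Yxx Yzz Zxx Zyy]] := splits.
exact: (crossing_skew simpleM conM triT0 Tx Ty Tz nxz nyz sX sY Xyy Xzz Yxx Yzz).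
Qed.

Lemma crossing_parallel_card : rk (Xz :&: Yx) <= 2 -> 1 < #|Xz :&: Yz|.
Proof.
have [[Tx Ty Tz] [nxy nxz nyz] [sX sY sZ] [Xyy Xzz] [Yxx Yzz Zxx Zyy]] := splits.
exact: (crossing_card_parallel simpleM conM triT0 rM Tx Ty sX sY Xyy noC).
Qed.

Local Notation h1 := #|Xy :&: Yx :&: Zx|.
Local Notation h2 := #|Xy :&: Yx :&: Zy|.
Local Notation h3 := #|Xy :&: Yz :&: Zy|.
Local Notation h4 := #|Xz :&: Yz :&: Zy|.
Local Notation h5 := #|Xz :&: Yz :&: Zx|.
Local Notation h6 := #|Xz :&: Yx :&: Zx|.
Local Notation p := #|Xy :&: Yz :&: Zx|.
Local Notation q := #|Xz :&: Yx :&: Zy|.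

(** The third partition cuts an edge into two cells; a successor counts the triangle element removed
    by that partition when the edge contains it. The final 3 is the triangle. *)
Lemma card_edges :
  [/\ #|Xy :&: Yx| = h1 + h2, #|Xz :&: Zx| = h5 + h6 & #|Yz :&: Zy| = h3 + h4] /\
  [/\ #|Yx :&: Zx| = (h1 + h6).+1, #|Xy :&: Zy| = (h2 + h3).+1 &
      #|Xz :&: Yz| = (h4 + h5).+1] /\
  [/\ #|Xy :&: Zx| = p + h1, #|Xy :&: Yz| = p + h3 & #|Yz :&: Zx| = p + h5] /\
  [/\ #|Yx :&: Zy| = q + h2, #|Xz :&: Zy| = q + h4 & #|Xz :&: Yx| = q + h6] /\
  #|E| = h1 + h2 + h3 + h4 + h5 + h6 + p + q + 3.
Proof.
have [[Tx Ty Tz] [nxy nxz nyz] [sX sY sZ] [Xyy Xzz] [Yxx Yzz Zxx Zyy]] := splits.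
have [sXyE sXzE [sYxE sYzE sZxE sZyE]] := sides_sub.
have [[n1 n2 n3 n4] [[n5 n6 n7 n8] [n9 n10 n11 n12]]] := sides_notin.
have splitX A := card_split (A := A) (inE0 Tx) sX.
have splitY A := card_split (A := A) (inE0 Ty) sY.
have splitZ A := card_split (A := A) (inE0 Tz) sZ.
have sI A B : A \subset E -> A :&: B \subset E by apply/subset_trans/subsetIl.
have triple A B C : A :&: B :&: C = C :&: A :&: B by rewrite [LHS]setIC setIA.
have e1 : #|Xy :&: Yx| = h1 + h2 by rewrite splitZ ?sI // inE (negbTE n3).
have e2 : #|Xy :&: Yz| = p + h3 by rewrite splitZ ?sI // inE (negbTE n3).
have e3 : #|Xz :&: Yx| = q + h6.
  by rewrite splitZ ?sI // inE (negbTE n7) andbF add0n addnC.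
have e4 : #|Xz :&: Yz| = (h4 + h5).+1.
  by rewrite splitZ ?sI // inE Xzz Yzz -addnA [_ + h4]addnC.
have e5 : #|Xy :&: Zx| = p + h1.
  by rewrite splitY ?sI // inE (negbTE n11) andbF add0n addnC !(setIAC Xy Zx).
have e6 : #|Xy :&: Zy| = (h2 + h3).+1.
  by rewrite splitY ?sI // inE Xyy Zyy -addnA !(setIAC Xy Zy).
have e7 : #|Xz :&: Zx| = h5 + h6.
  by rewrite splitY ?sI // inE (negbTE n11) andbF add0n addnC !(setIAC Xz Zx).
have e8 : #|Xz :&: Zy| = q + h4.
  by rewrite splitY ?sI // inE (negbTE n4) !(setIAC Xz Zy).
have e9 : #|Yx :&: Zx| = (h1 + h6).+1.
  by rewrite splitX ?sI // inE Yxx Zxx -addnA !(triple Yx Zx).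
have e10 : #|Yx :&: Zy| = q + h2.
  by rewrite splitX ?sI // inE (negbTE n12) andbF add0n addnC !(triple Yx Zy).
have e11 : #|Yz :&: Zx| = p + h5.
  by rewrite splitX ?sI // inE (negbTE n8) add0n !(triple Yz Zx).
have e12 : #|Yz :&: Zy| = h3 + h4.
  by rewrite splitX ?sI // inE (negbTE n8) add0n !(triple Yz Zy).
do 4 (split; first by split).
rewrite (splitX E) // (inE0 Tx) (setIidPr sXyE) (setIidPr sXzE).
rewrite (splitY Xy) // (splitY Xz) // Xyy (negbTE n4) e1 e2 e3 e4.
by clear; lia.
Qed.

Lemma concurrent_cells : no_four_point_line -> 1 < p ->
  (rk (Xy :&: Zx) <= 2 -> rk (Xy :&: Yz) <= 2 -> p + h1 + h3 <= 3) /\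
  (rk (Xy :&: Zx) <= 2 -> rk (Yz :&: Zx) <= 2 -> p + h1 + h5 <= 3) /\
  (rk (Xy :&: Yz) <= 2 -> rk (Yz :&: Zx) <= 2 -> p + h3 + h5 <= 3).
Proof.
move=> noU p1; have [sXyE sXzE [sYxE sYzE sZxE sZyE]] := sides_sub.
have [_ [_ [[c1 c3 c5] _]]] := card_edges.
have I1 : Zx :&: Xy :&: Yz = Xy :&: Yz :&: Zx by rewrite -setIA setIC.
have I2 : Yz :&: Xy :&: Zx = Xy :&: Yz :&: Zx by rewrite (setIC Yz).
have := concurrent_lines_card noU sZxE; have := concurrent_lines_card noU sYzE.
move/(_ Xy Zx); rewrite I2 [Yz :&: Xy]setIC c3 c5 => /(_ p1) L2.
move/(_ Xy Yz); rewrite I1 [Zx :&: Xy]setIC [Zx :&: Yz]setIC c1 c5 => /(_ p1) L1.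
have := @concurrent_lines_card Xy Yz Zx noU sXyE p1; rewrite c1 c3 => L3.
split; [|split] => rA rB.
- by move: (L3 rB rA); clear; lia.
- by move: (L1 rA rB); clear; lia.
- by move: (L2 rA rB); clear; lia.
Qed.

Lemma rank_sides : [/\ rk Xy + rk Xz = r + 2, rk Yx + rk Yz = r + 2,
  rk Yx <= rk (Yx :&: Zx) + rk (Yx :&: Zy), rk Yz <= rk (Xy :&: Yz) + rk (Xz :&: Yz) &
  rk Xy <= (rk (Xy :&: Yx) + rk (Xy :&: Yz)).+1 /\
  rk Xz <= (rk (Xz :&: Zx) + rk (Xz :&: Zy)).+1].
Proof.
have [[Tx Ty Tz] [nxy nxz nyz] [sX sY sZ] [Xyy Xzz] [Yxx Yzz Zxx Zyy]] := splits.
have [sXyE sXzE [sYxE sYzE sZxE sZyE]] := sides_sub.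
have [[n1 n2 n3 n4] [[n5 n6 n7 n8] [n9 n10 n11 n12]]] := sides_notin.
have rX := split_off_rank_sum conM rM (inE0 Tx) sX.
have rY := split_off_rank_sum conM rM (inE0 Ty) sY.
have := rank_split (inE0 Ty) sY sXyE; have := rank_split (inE0 Tz) sZ sXzE.
have := rank_split (inE0 Tz) sZ sYxE; have := rank_split (inE0 Tx) sX sYzE.
rewrite Xyy Xzz (negbTE n7) (negbTE n8) ![Yz :&: _]setIC.
by split.
Qed.

End Cells.

(** * Cases by the number of lines *)

Section Cases.
Variables (x y z : T) (Xy Xz Yx Yz Zx Zy : {set T}).
Hypothesis splits : three_splits x y z Xy Xz Yx Yz Zx Zy.

Local Notation h1 := #|Xy :&: Yx :&: Zx|.
Local Notation h2 := #|Xy :&: Yx :&: Zy|.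
Local Notation h3 := #|Xy :&: Yz :&: Zy|.
Local Notation h4 := #|Xz :&: Yz :&: Zy|.
Local Notation h5 := #|Xz :&: Yz :&: Zx|.
Local Notation h6 := #|Xz :&: Yx :&: Zx|.
Local Notation p := #|Xy :&: Yz :&: Zx|.
Local Notation q := #|Xz :&: Yx :&: Zy|.

(** Exchanging [y] and [z] exchanges the cells [p] and [q]. *)
Lemma concurrent_cells_swap : no_four_point_line -> 1 < q ->
  (rk (Xz :&: Yx) <= 2 -> rk (Xz :&: Zy) <= 2 -> q + h6 + h4 <= 3) /\
  (rk (Xz :&: Yx) <= 2 -> rk (Yx :&: Zy) <= 2 -> q + h6 + h2 <= 3) /\
  (rk (Xz :&: Zy) <= 2 -> rk (Yx :&: Zy) <= 2 -> q + h4 + h2 <= 3).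
Proof.
move=> noU; have := concurrent_cells (three_splits_swap splits) noU.
by rewrite !(setIAC Xz Zy) (setIAC Xz Zx) (setIAC Xy Zy) [Zy :&: Yx]setIC.
Qed.

Lemma crossing_line_cells :
  [/\ rk (Yx :&: Zx) <= 2 -> [/\ h1 <= 1, h6 <= 1 &
    [/\ 1 < #|Yz :&: Zx|, 1 < #|Yx :&: Zy|, rk (Yz :&: Zx) <= 2 & rk (Yx :&: Zy) <= 2]],
  rk (Xy :&: Zy) <= 2 -> [/\ h2 <= 1, h3 <= 1 &
    [/\ 1 < #|Xz :&: Zy|, 1 < #|Xy :&: Zx|,
        rk (Xz :&: Zy) <= 2 & rk (Xy :&: Zx) <= 2]] &
  rk (Xz :&: Yz) <= 2 -> [/\ h5 <= 1, h4 <= 1 &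
    [/\ 1 < #|Xy :&: Yz|, 1 < #|Xz :&: Yx|,
        rk (Xy :&: Yz) <= 2 & rk (Xz :&: Yx) <= 2]]].
Proof.
have := crossing_line (three_splits_rot splits).
have := crossing_line (three_splits_swap splits).
have := crossing_line splits.
rewrite !(setIAC Xy Zy) ![Yx :&: Zx :&: _]setIC !setIA.
by split.
Qed.

Lemma line_edges_card : no_four_point_line ->
  [/\ rk (Xy :&: Yz) <= 2 -> #|Xy :&: Yz| <= 3,
      rk (Yz :&: Zx) <= 2 -> #|Yz :&: Zx| <= 3 &
  [/\ rk (Yx :&: Zy) <= 2 -> #|Yx :&: Zy| <= 3,
      rk (Xz :&: Zy) <= 2 -> #|Xz :&: Zy| <= 3 &
      rk (Xz :&: Yx) <= 2 -> #|Xz :&: Yx| <= 3]].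
Proof.
move=> noU; have [sXyE sXzE [sYxE sYzE sZxE sZyE]] := sides_sub splits.
split; last split; apply: (simple_line_card simpleM noU);
  exact: subset_trans (subsetIl _ _) _.
Qed.

Lemma tiny_edges_card :
  [/\ rk (Xy :&: Zx) <= 1 -> #|Xy :&: Zx| <= 1,
      rk (Xz :&: Zy) <= 1 -> #|Xz :&: Zy| <= 1 &
      rk (Xz :&: Yx) <= 1 -> #|Xz :&: Yx| <= 1].
Proof.
have [sXyE sXzE _] := sides_sub splits.
by split; apply: (simple_rank_leq1 simpleM); apply: subset_trans (subsetIl _ _) _.
Qed.

(** Each of [Yx] and [Yz] is covered by two lines, so [r + 2] is at most 8. *)
Lemma rank_leq6 : rk (Yx :&: Zx) <= 2 -> rk (Xz :&: Yz) <= 2 -> r <= 6.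
Proof.
move=> rSx rSz; have [/(_ rSx)[_ _ [_ _ _ r2]] _ /(_ rSz)[_ _ [_ _ r3 _]]] :=
  crossing_line_cells.
have [_ + + + _] := rank_sides splits.
by move: rSx rSz r2 r3; clear; lia.
Qed.

Lemma three_lines : rk (Yx :&: Zx) <= 2 -> rk (Xy :&: Zy) <= 2 ->
  rk (Xz :&: Yz) <= 2 -> r <= 6 /\ (no_four_point_line -> small_ground).
Proof.
move=> rSx rSy rSz; split=> [|noU]; first exact: rank_leq6.
have [/(_ rSx)[l1 l6 [_ _ r5 r2]] /(_ rSy)[l2 l3 [_ _ r4 r1]]
  /(_ rSz)[l5 l4 [_ _ r3 r6]]] :=
  crossing_line_cells.
have [_ [[cSx _ cSz] [_ [_ cE]]]] := card_edges splits.
have P : 1 < p -> [/\ p + h1 + h3 <= 3, p + h1 + h5 <= 3 & p + h3 + h5 <= 3].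
  by case/(concurrent_cells splits noU)=> L1 [L2 L3]; split; auto.
have Q : 1 < q -> [/\ q + h2 + h4 <= 3, q + h2 + h6 <= 3 & q + h4 + h6 <= 3].
  case/(concurrent_cells_swap noU)=> L1 [L2 L3].
  by move: (L1 r6 r4) (L2 r6 r2) (L3 r4 r2); clear; split; lia.
have [||||||le8 eq8] :=
    @count_three_lines _ _ _ _ _ _ p q l1 l2 l3 l4 l5 l6;
  try by [case/P | case/Q].
rewrite /small_ground cE; split; first by move: le8; clear; lia.
move/eqP; rewrite (eqn_add2r 3 _ 8) => /eqP/eq8[e1 e2].
rewrite e1 in cSx; rewrite e2 in cSz.
have [[Tx Ty Tz] _ _ _ _] := splits.
have [sXyE sXzE [sYxE sYzE sZxE sZyE]] := sides_sub splits.
have [[n1 n2 n3 n4] [[n5 n6 n7 n8] _]] := sides_notin splits.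
(* These two lines lie on opposite sides of the partition for [y], so they are disjoint and both
   miss [y]. *)
apply: (@small_ground_triangles y y (Yx :&: Zx) (Xz :&: Yz)) => //.
- by rewrite inE (negbTE n5).
- by rewrite inE (negbTE n4).
- exact: subset_trans (subsetIl _ _) _.
- exact: subset_trans (subsetIl _ _) _.
have [_ _ [_ [_ dY _ _ _] _] _ _] := splits.
exact: disjointW (subsetIl _ _) (subsetIr _ _) dY.
Qed.

Lemma two_lines : rk (Yx :&: Zx) <= 2 -> 2 < rk (Xy :&: Zy) ->
  rk (Xz :&: Yz) <= 2 -> r <= 6 /\ (no_four_point_line -> small_ground).
Proof.
move=> rSx rSy rSz; split=> [|noU]; first exact: rank_leq6.
have [/(_ rSx)[l1 l6 [p5 q2 r5 r2]] _ /(_ rSz)[l5 l4 [p3 q6 r3 r6]]] :=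
  crossing_line_cells.
have [/(_ r3) + /(_ r5) + [/(_ r2) + _ /(_ r6) +]] := line_edges_card noU.
have [+ + _] := tiny_edges_card.
have skew := crossing_skew_rank (three_splits_swap splits).
have [cDy cSy] := crossing_nonline (three_splits_swap splits) rSy.
have [[_ eDy _] [[_ eSy _] [[e1 e3 e5] [[e2 e4 e6] cE]]]] := card_edges splits.
rewrite e1 e4.
rewrite eDy in cDy; rewrite eSy ltnS in cSy.
move: (p3) (p5) (q2) (q6); rewrite e3 e5 e2 e6 => {}p3 {}p5 {}q2 {}q6.
move=> c1 d1 p3' p5' q2' q6'.
have P3 : 1 < p -> p + h3 + h5 <= 3.
  by case/(concurrent_cells splits noU)=> _ [_ L]; apply: L.
have P1 : 1 < p -> rk (Xy :&: Zx) <= 2 -> p + h1 + h3 <= 3.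
  by case/(concurrent_cells splits noU)=> L _ r1; apply: L.
have Q2 : 1 < q -> q + h2 + h6 <= 3.
  by case/(concurrent_cells_swap noU)=> _ [L _]; rewrite addnAC; apply: L.
have Q4 : 1 < q -> rk (Xz :&: Zy) <= 2 -> q + h2 + h4 <= 3.
  by case/(concurrent_cells_swap noU)=> _ [_ L] r4; rewrite addnAC; apply: L.
rewrite addnC in skew.
have B3 : 1 < p + h3 <= 3 by rewrite p3.
have B5 : 1 < p + h5 <= 3 by rewrite p5.
have B2 : 1 < q + h2 <= 3 by rewrite q2.
have B6 : 1 < q + h6 <= 3 by rewrite q6.
have [le8 eq8] := count_two_lines l1 l4 cDy cSy B3 B6 B2 B5 skew c1 d1 P3 P1 Q2 Q4.
rewrite /small_ground cE; split; first by move: le8; clear; lia.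
move/eqP; rewrite (eqn_add2r 3 _ 8) => /eqP/eq8 {}eq8.
have [[Tx Ty Tz] _ [[_ dX _ _ _] [_ dY _ _ _] [_ dZ _ _ _]] _ _] := splits.
have [sXyE sXzE [sYxE sYzE sZxE sZyE]] := sides_sub splits.
have [[n1 n2 _ _] [[n5 _ _ _] _]] := sides_notin splits.
have sI A B : A \subset E -> A :&: B \subset E by apply/subset_trans/subsetIl.
have nI v A B : v \notin A -> v \notin A :&: B by rewrite inE => /negbTE ->.
case: eq8 => [[cA cB]|[[rA [cA cB]]|[rA [cA cB]]]].
- rewrite -e3 in cA; rewrite -e2 in cB.
  apply: (small_ground_triangles Tx Ty (nI _ _ Yz n1) (nI _ _ Zy n5));
    try exact: sI; try by [].
  by rewrite disjoint_sym; apply: disjointW (subsetIl _ _) (subsetIr _ _) dY.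
- rewrite -e1 in cA; rewrite -e2 in cB.
  apply: (small_ground_triangles Tx Ty (nI _ _ Zx n1) (nI _ _ Zy n5));
    try exact: sI; try by [].
  exact: disjointW (subsetIr _ _) (subsetIr _ _) dZ.
rewrite -e4 in cA; rewrite -e3 in cB.
apply: (small_ground_triangles Tx Tx (nI _ _ Zy n2) (nI _ _ Yz n1));
    try exact: sI; try by [].
by rewrite disjoint_sym; apply: disjointW (subsetIl _ _) (subsetIl _ _) dX.
Qed.

(** Each of [Xy] and [Xz] turns out to be a line, at most one cell point and one triangle point,
    hence of rank at most 4; so [r + 2 <= 8]. With three-point lines [|E|] is at most
    [3 + 3 + 1 + 1 + 3], and equality makes both lines triangles. *)
Lemma one_line : rk (Yx :&: Zx) <= 2 -> 2 < rk (Xy :&: Zy) ->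
  2 < rk (Xz :&: Yz) -> r <= 6 /\ (no_four_point_line -> small_ground).
Proof.
move=> rSx rSy rSz.
have [/(_ rSx)[l1 l6 [p5 q2 r5 r2]] _ _] := crossing_line_cells.
have [c1 _ b1] := tiny_edges_card.
have skewz := crossing_skew_rank splits.
have skewy := crossing_skew_rank (three_splits_swap splits); rewrite addnC in skewy.
have [cDy cSy] := crossing_nonline (three_splits_swap splits) rSy.
have [cDz cSz] := crossing_nonline splits rSz.
have cSx := crossing_parallel_card (three_splits_rot splits) r2.
have [[eDz eDy _] [[eSx eSy eSz] [[e1 e3 e5] [[e2 e4 e6] cE]]]] := card_edges splits.
have [ra rd] : rk (Xy :&: Yz) <= 2 /\ rk (Xz :&: Zy) <= 2.
  rewrite eDy in cDy; rewrite eDz in cDz; rewrite eSy ltnS in cSy.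
  rewrite eSz ltnS in cSz; rewrite eSx ltnS in cSx.
  rewrite e1 in c1; rewrite e6 in b1.
  rewrite e5 in p5; rewrite e2 in q2.
  exact: rank_one_line cDy cDz cSy cSz q2 p5 cSx skewz skewy b1 c1.
have [sXyE sXzE [sYxE sYzE sZxE sZyE]] := sides_sub splits.
have rDz := rank_leq_card M (Xy :&: Yx); have rDy := rank_leq_card M (Xz :&: Zx).
split=> [|noU].
  have [+ _ _ _ [+ +]] := rank_sides splits.
  by move: ra rd rDz rDy cDz cDy; clear; lia.
have [+ _ [_ + _]] := line_edges_card noU.
move=> /(_ ra) p3' /(_ rd) q4'.
have eE : #|E| = #|Xy :&: Yz| + #|Xz :&: Zy| + #|Xy :&: Yx| + #|Xz :&: Zx| + 3.
  by rewrite cE e3 e4 eDz eDy; clear; lia.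
rewrite /small_ground eE; split; first by move: p3' q4' cDz cDy; clear; lia.
move=> e11; have [[Tx Ty Tz] _ [[_ dX _ _ _] _ _] _ _] := splits.
have [[n1 n2 _ _] _] := sides_notin splits.
have sI A B : A \subset E -> A :&: B \subset E by apply/subset_trans/subsetIl.
have nI v A B : v \notin A -> v \notin A :&: B by rewrite inE => /negbTE ->.
apply: (small_ground_triangles Tx Tx (nI _ _ Yz n1) (nI _ _ Zy n2));
  try (exact: ra || exact: rd || exact: sI).
- exact: disjointW (subsetIl _ _) (subsetIl _ _) dX.
- by move: p3' q4' cDz cDy e11; clear; lia.
- by move: p3' q4' cDz cDy e11; clear; lia.
Qed.

(** The six hexagon cells, paired one way, total at most 3; paired the other way, they total at
    least 6. *)
Lemma no_line : 2 < rk (Yx :&: Zx) -> 2 < rk (Xy :&: Zy) -> 2 < rk (Xz :&: Yz) -> False.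
Proof.
move=> rSx rSy rSz.
have := crossing_nonline splits rSz.
have := crossing_nonline (three_splits_swap splits) rSy.
have := crossing_nonline (three_splits_rot splits) rSx.
have [[-> -> ->] [[-> -> ->] _]] := card_edges splits.
by clear; lia.
Qed.

End Cases.

Lemma three_splits_bound x y z Xy Xz Yx Yz Zx Zy :
  three_splits x y z Xy Xz Yx Yz Zx Zy ->
  r <= 6 /\ (no_four_point_line -> small_ground).
Proof.
move=> splits; have rot := three_splits_rot splits; have rot2 := three_splits_rot rot.
have [rSx|rSx] := leqP (rk (Yx :&: Zx)) 2; have [rSy|rSy] := leqP (rk (Xy :&: Zy)) 2;
  have [rSz|rSz] := leqP (rk (Xz :&: Yz)) 2.
- exact: three_lines splits _ _ _.
- by apply: (two_lines rot); rewrite 1?setIC // ; rewrite setIC.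
- exact: two_lines splits _ _ _.
- exact: one_line splits _ _ _.
- by apply: (two_lines rot2); rewrite 1?setIC //; rewrite setIC.
- by apply: (one_line rot); rewrite 1?setIC //; rewrite setIC.
- by apply: (one_line rot2); rewrite 1?setIC //; rewrite setIC.
- by case: (no_line splits).
Qed.

End ThreeSplits.

(** Since [y] and [z] span [x], deleting [x] keeps the rank, and no side of the partition can
    contain both [y] and [z]. *)
Lemma split_off_triangle (T : finType) (M : matroid T) (T0 : {set T}) (x y z : T) :
  simple M -> vertically_connected M 4 -> triangle M T0 ->
  x \in T0 -> y \in T0 -> z \in T0 -> x != y -> x != z -> y != z ->
  ~ vertically_connected (delete M x) 4 ->
  exists X Y, [/\ split_off M x X Y, y \in X & z \in Y].
Proof.
move=> simpleM conM triT0 Tx Ty Tz nxy nxz nyz ncon.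
have sT0 := subsetP (triangle_sub triT0).
have Ex := sT0 x Tx.
have inD v : v \in T0 -> x != v -> v \in ground M :\ x.
  by move=> Tv nxv; rewrite !inE eq_sym nxv sT0.
have rx : rank M (ground M :\ x) = rank M (ground M).
  apply/eqP; rewrite eqn_leq rank_mono ?subsetDl //.
  rewrite -{1}(setD1K Ex).
  exact: (triangle_span simpleM triT0 Ty Tz nyz Tx (inD _ Ty nxy) (inD _ Tz nxz)).
have [X [Y sXY]] := not_vertically_connected_delete rx ncon.
wlog Xy : X Y sXY / y \in X.
  move=> wlogX; have [Xy|nXy] := boolP (y \in X); first exact: wlogX sXY Xy.
  apply: wlogX (split_off_sym sXY) _.
  by rewrite (split_off_mem sXY (sT0 y Ty)) nXy eq_sym nxy.
exists X, Y; split=> //; rewrite (split_off_mem sXY (sT0 z Tz)) eq_sym nxz /=.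
apply/negP=> Xz; have := split_off_rankU1 conM Ex sXY.
by rewrite ltnNge (triangle_span simpleM triT0 Ty Tz nyz Tx Xy Xz).
Qed.

Theorem theorem3p2 (T : finType) (M : matroid T) (e f g : T)
    (simpleM : simple M)
    (conM : vertically_connected M 4)
    (triM : triangle M [set e; f; g])
    (con_e : ~ vertically_connected (delete M e) 4)
    (con_f : ~ vertically_connected (delete M f) 4)
    (con_g : ~ vertically_connected (delete M g) 4) :
  (exists C : {set T},
     [/\ cocircuit M C, #|C :&: [set e; f; g]| = 2 &
         exists2 k : nat, 2 <= k &
           isomorphic (restrict M C) (dsum (uniform 2 k) (uniform 2 2))])
  \/
  (rank M (ground M) <= 6 /\
   ((forall X : {set T}, X \subset ground M ->
       ~ isomorphic (restrict M X) (uniform 2 4)) ->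
    #|ground M| <= 11 /\
    (#|ground M| = 11 ->
     exists T1 T2 : {set T},
       [/\ triangle M T1, triangle M T2, [disjoint T1 & T2],
           T1 <> [set e; f; g] & T2 <> [set e; f; g]]))).
Proof.
have [nef neg nfg] : [/\ e != f, e != g & f != g].
  have := triangle_card triM; rewrite -setUA cardsU1 cards2 !inE negb_or.
  by case: (e == f); case: (e == g); case: (f == g).
have [Te Tf Tg] : [/\ e \in [set e; f; g], f \in [set e; f; g] & g \in [set e; f; g]].
  by rewrite !inE !eqxx !orbT.
have [nfe nge ngf] : [/\ f != e, g != e & g != f] by split; rewrite eq_sym.
have [Xf [Xg [sX Xff Xgg]]] :=
  split_off_triangle simpleM conM triM Te Tf Tg nef neg nfg con_e.
have [Ye [Yg [sY Yee Ygg]]] :=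
  split_off_triangle simpleM conM triM Tf Te Tg nfe nfg neg con_f.
have [Ze [Zf [sZ Zee Zff]]] :=
  split_off_triangle simpleM conM triM Tg Te Tf nge ngf nef con_g.
have [/existsP[C goodC]|noC] :=
    boolP [exists C : {set T}, line_pair_cocircuit M [set e; f; g] C].
  left; exists C; have := line_pair_cocircuit_isomorphic simpleM goodC.
  by case/and4P: goodC => cocC /eqP cC _ _ isoC.
right; have [r4|r3] := ltnP 3 (rank M (ground M)).
  have splits : three_splits M [set e; f; g] e f g Xf Xg Ye Yg Ze Zf by split.
  exact: (three_splits_bound simpleM conM triM r4 (elimN existsP noC) splits).
split=> [|noU]; first exact: leq_trans r3 _.
have [_ _ ltXf ltXg _] := sX.
have sXf := split_off_subE sX; have sXg := split_off_subE (split_off_sym sX).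
have cXf := simple_line_card simpleM noU sXf (ltnSE (leq_trans ltXf r3)).
have cXg := simple_line_card simpleM noU sXg (ltnSE (leq_trans ltXg r3)).
have Ee := subsetP (triangle_sub triM) e Te.
have := card_split Ee sX (subxx _); rewrite Ee (setIidPr sXf) (setIidPr sXg) => ->.
have le7 : true + #|Xf| + #|Xg| <= 7 by move: cXf cXg; clear; lia.
by split; [apply: leq_trans le7 _ | move=> eq11; rewrite eq11 in le7].
Qed.
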